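(* Let $\beta>2$ and, in cylindrical coordinates $(r,\theta,x_3)$ in $\mathbb{R}^3$, let $D_*=\bigcup_{j=1}^\infty S_j$, where $$S_j=\{(r,x_3):\ 2^{-j}\le r<2^{-(j-1)},\ 0<x_3<2^{-\beta(j-1)}\}\qquad(\theta\in[0,2\pi)).$$ Let $\eta=\eta(t)$ be a smooth function of time $t\ge0$ with $\eta(t)=0$ for $t\in[0,1]$ and $\eta(t)=1$ for $t\ge2$. Then $v:=\frac{\eta(t)}{r}e_\theta$ is an unbounded solution (with some pressure $P$) of the forced axially symmetric Navier-Stokes equation $$\Delta v-(v\cdot\nabla)v-\nabla P-\partial_tv=-\frac{\eta'(t)}{r}e_\theta\quad\text{on } D_*\times[0,\infty),\qquad \nabla\cdot v=0,$$ which satisfies the Navier-Hodge-Lions boundary condition $v\cdot n=0$, $(\nabla\times v)\times n=0$ on $\partial D_*$. Moreover, for any $T>0$, $v$ is in the energy space with respect to $D_*\times[0,T]$, and the forcing term $-\frac{\eta'(t)}{r}e_\theta$ is in the standard regularity class $L^\infty_tL^{1.5+}_x(D_*\times[0,T])$.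
   Context: Cylindrical coordinates: $r=\sqrt{x_1^2+x_2^2}$, $e_\theta=(-x_2/r,x_1/r,0)$. $D_*$ is viewed as a domain of revolution in $\mathbb{R}^3$. $n$ is the unit outward normal on the smooth part of $\partial D_*$ (which consists of horizontal and vertical pieces). The energy space with respect to $D_*\times[0,T]$ is $L^2_tH^1_x\cap L^\infty_tL^2_x$, with norm given by $\|v\|^2=\int_0^T\int_{D_*}|\nabla v|^2\,dx\,dt+\sup_{t\in[0,T]}\int_{D_*}|v(x,t)|^2\,dx$. $L^\infty_tL^{1.5+}_x$ means $L^\infty_tL^p_x$ for some $p>\frac32$. *)

(* Defs.v *)
From HB Require Import structures.
From mathcomp Require Import all_boot all_order all_algebra.
From mathcomp Require Import all_classical all_reals all_analysis.
From mathcomp Require Import ess_sup_inf hoelder.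

Set Implicit Arguments.
Unset Strict Implicit.
Unset Printing Implicit Defensive.

Import Order.TTheory GRing.Theory Num.Theory.
Import numFieldNormedType.Exports.

Local Open Scope classical_set_scope.
Local Open Scope ring_scope.

(* Points and vectors of R^3 are row vectors; the coordinates x_1, x_2, x_3
   are x 0 0, x 0 1, x 0 2.  The library norm on 'rV[R]_3 is the sup norm
   (same topology), so the Euclidean norm enorm is defined separately. *)

Section Vectors.
Variable R : realType.
Local Notation V := 'rV[R]_3.

Definition vec3 (a b c : R) : V := \row_i [:: a; b; c]`_i.
Definition ebase (i : 'I_3) : V := delta_mx 0 i.
Definition dotv (u w : V) : R := \sum_i u 0 i * w 0 i.
Definition enorm (u : V) : R := Num.sqrt (dotv u u).

(* Indices are in Z/3, so that the three components of a cross product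
   (and of a curl) are cyclic shifts of each other. *)
Definition crossv (u w : V) : V :=
  \row_i (u 0 (i + 1) * w 0 (i + 2) - u 0 (i + 2) * w 0 (i + 1)).

Definition cyl_radius (x : V) : R := Num.sqrt (x 0 0 ^+ 2 + x 0 1 ^+ 2).
Definition e_r (x : V) : V := vec3 (x 0 0 / cyl_radius x) (x 0 1 / cyl_radius x) 0.
Definition e_theta (x : V) : V := vec3 (- x 0 1 / cyl_radius x) (x 0 0 / cyl_radius x) 0.
Definition e_3 : V := vec3 0 0 1.

End Vectors.

Section SpaceDerivatives.
Variable R : realType.
Local Notation V := 'rV[R]_3.

Definition partial (i : 'I_3) (g : V -> R) (x : V) : R := 'D_(ebase R i) g x.
Definition component (u : V -> V) (i : 'I_3) (x : V) : R := u x 0 i.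

Definition grad (g : V -> R) (x : V) : V := \row_i partial i g x.
Definition divergence (u : V -> V) (x : V) : R := \sum_i partial i (component u i) x.
Definition curl (u : V -> V) (x : V) : V :=
  \row_i (partial (i + 1) (component u (i + 2)) x
          - partial (i + 2) (component u (i + 1)) x).
Definition laplacian (u : V -> V) (x : V) : V :=
  \row_i \sum_j partial j (partial j (component u i)) x.
(* (w . grad) u *)
Definition convect (w u : V -> V) (x : V) : V :=
  \row_i \sum_j w x 0 j * partial j (component u i) x.

End SpaceDerivatives.

(* Functions of time live on [0, +oo): derivatives are taken within the half
   line (hence one-sided at t = 0), and values at negative times are
   irrelevant. *)
Section TimeDerivatives.
Variable R : realType.

Definition time_quotient (f : R -> R) (t h : R) : R :=
  h^-1 * (f (t + h) - f t).
Definition time_increments (t : R) : set_system R :=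
  within [set h | 0 <= t + h] 0^'.
Definition time_derivable (f : R -> R) (t : R) : Prop :=
  cvg (time_quotient f t @ time_increments t).
Definition time_derive (f : R -> R) (t : R) : R :=
  lim (time_quotient f t @ time_increments t).
Definition time_smooth (f : R -> R) : Prop :=
  forall (n : nat) (t : R), 0 <= t -> time_derivable (iter n time_derive f) t.

End TimeDerivatives.

Section NavierStokes.
Variable R : realType.
Local Notation V := 'rV[R]_3.

(* Time-dependent fields take the time first. *)
Definition time_partial (u : R -> V -> V) (t : R) (x : V) : V :=
  \row_i time_derive (fun s => u s x 0 i) t.

Definition continuous_on_cylinder (D : set V) (g : R -> V -> R) : Prop :=
  {within [set z : R * V | 0 <= z.1 /\ D z.2],
    continuous (fun z : R * V => g z.1 z.2)}.

(* C^2 in x and C^1 in t on D x [0, +oo) *)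
Definition regular_velocity (D : set V) (v : R -> V -> V) : Prop :=
  [/\ forall t x i, 0 <= t -> D x ->
        [/\ time_derivable (fun s => v s x 0 i) t,
            forall j, derivable (component (v t) i) x (ebase R j) &
            forall j k,
              derivable (partial j (component (v t) i)) x (ebase R k)],
      forall i, continuous_on_cylinder D (fun t => component (v t) i),
      forall i j,
        continuous_on_cylinder D (fun t => partial j (component (v t) i)),
      forall i j k, continuous_on_cylinder D
        (fun t => partial k (partial j (component (v t) i))) &
      forall i, continuous_on_cylinder D
        (fun t x => time_partial v t x 0 i)].

(* C^1 in x *)
Definition regular_pressure (D : set V) (P : R -> V -> R) : Prop :=
  [/\ forall t x j, 0 <= t -> D x -> derivable (P t) x (ebase R j),
      continuous_on_cylinder D P &
      forall j, continuous_on_cylinder D (fun t => partial j (P t))].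

(* The forcing term is on the right-hand side, with the sign convention
   Delta v - (v . grad) v - grad P - d_t v = f. *)
Definition navier_stokes_solution (D : set V) (f v : R -> V -> V)
    (P : R -> V -> R) : Prop :=
  [/\ regular_velocity D v, regular_pressure D P &
      forall t x, 0 <= t -> D x ->
        laplacian (v t) x - convect (v t) (v t) x - grad (P t) x
          - time_partial v t x = f t x /\
        divergence (v t) x = 0].

(* The components in the frame (e_r, e_theta, e_3) do not depend on theta. *)
Definition axisymmetric_vector (D : set V) (u : V -> V) : Prop :=
  forall x y, D x -> D y -> 0 < cyl_radius x -> cyl_radius x = cyl_radius y -> x 0 2 = y 0 2 ->
    [/\ dotv (u x) (e_r x) = dotv (u y) (e_r y),
        dotv (u x) (e_theta x) = dotv (u y) (e_theta y) &
        dotv (u x) (e_3 R) = dotv (u y) (e_3 R)].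
Definition axisymmetric_scalar (D : set V) (g : V -> R) : Prop :=
  forall x y, D x -> D y -> 0 < cyl_radius x -> cyl_radius x = cyl_radius y -> x 0 2 = y 0 2 ->
    g x = g y.

(* n is the unit outward normal to the boundary of D at x, a point near which
   the interior of D is {rho < 0} and its closure {rho <= 0}, for a C^1
   function rho without critical points.  The points x that admit such an n
   form the smooth part of the boundary. *)
Definition outward_normal (D : set V) (x n : V) : Prop :=
  exists rho : V -> R,
    [/\ rho x = 0,
        grad rho x != 0,
        \forall y \near x,
          differentiable rho y /\ {for y, continuous (grad rho)},
        \forall y \near x,
          (D° y <-> rho y < 0) /\ (closure D y <-> rho y <= 0) &
        n = (enorm (grad rho x))^-1 *: grad rho x].

Definition navier_hodge_lions (D : set V) (v : R -> V -> V) : Prop :=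
  forall t x n, 0 <= t -> outward_normal D x n ->
    [/\ differentiable (v t) x,
        dotv (v t x) n = 0 &
        crossv (curl (v t) x) n = 0].

Definition unbounded_on (D : set V) (v : R -> V -> V) : Prop :=
  forall M : R, exists t x, [/\ 0 <= t, D x & M < enorm (v t x)].

End NavierStokes.

Section FunctionSpaces.
Variable R : realType.
Local Notation V := 'rV[R]_3.
Local Notation leb := (@lebesgue_measure R).

(* Lebesgue measure in R^3 is the product measure on (R * R) * R, transported
   to row vectors by of_coords. *)
Local Notation volume := ((leb \x leb) \x leb)%E.
Definition of_coords (z : R * R * R) : V := vec3 z.1.1 z.1.2 z.2.

Definition space_integral (D : set V) (g : V -> \bar R) : \bar R :=
  (\int[volume]_(z in of_coords @^-1` D) g (of_coords z))%E.

Definition measurable_on_cylinder (D : set V) (T : R) (g : R -> V -> R) :=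
  measurable_fun
    [set z : R * R * R * R | D (of_coords z.1) /\ `[0, T]%classic z.2]
    (fun z : R * R * R * R => g z.2 (of_coords z.1)).

(* C^oo with compact support contained in Omega *)
Definition test_function (Omega : set V) (phi : V -> R) : Prop :=
  (forall s : seq 'I_3,
     let g := foldr (fun i h => partial i h) phi s in
     continuous g /\ forall i x, derivable g x (ebase R i)) /\
  exists K : set V, [/\ compact K, K `<=` Omega &
    forall x, ~ K x -> phi x = 0].

Definition is_weak_partial (Omega : set V) (j : 'I_3) (u g : V -> R) : Prop :=
  forall phi, test_function Omega phi ->
    space_integral Omega (fun x => (u x * partial j phi x)%:E) =
    (- space_integral Omega (fun x => (g x * phi x)%:E))%E.

(* L^2_t H^1_x /\ L^oo_t L^2_x on D x [0, T]; G t x i j is the (weak)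
   derivative of the i-th component of v in the direction x_j. *)
Definition energy_norm_sq (D : set V) (T : R) (v : R -> V -> V)
    (G : R -> V -> 'M[R]_3) : \bar R :=
  ((\int[leb]_(t in `[0%R, T])
      space_integral D (fun x => (\sum_i \sum_j G t x i j ^+ 2)%R%:E))
   + ereal_sup [set space_integral D (fun x => (enorm (v t x) ^+ 2)%:E)
               | t in `[0%R, T]])%E.

Definition in_energy_space (D : set V) (T : R) (v : R -> V -> V) : Prop :=
  exists G : R -> V -> 'M[R]_3,
    [/\ forall i, measurable_on_cylinder D T (fun t x => v t x 0 i),
        forall i j, measurable_on_cylinder D T (fun t x => G t x i j),
        {ae leb, forall t, `[0, T]%classic t -> forall i j,
          is_weak_partial D° j (component (v t) i) (fun x => G t x i j)} &
        (energy_norm_sq D T v G < +oo)%E].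

Definition Lp_norm (D : set V) (p : R) (u : V -> V) : \bar R :=
  Lnorm volume p%:E
    ((fun z => (enorm (u (of_coords z)))%:E) \_ (of_coords @^-1` D)).

(* L^oo_t L^p_x on D x [0, T] *)
Definition in_Linfty_Lp (D : set V) (T p : R) (f : R -> V -> V) : Prop :=
  (forall i, measurable_on_cylinder D T (fun t x => f t x 0 i)) /\
  (ess_sup leb ((fun t => Lp_norm D p (f t)) \_ `[0%R, T]) < +oo)%E.

End FunctionSpaces.

Section Domain.
Variables (R : realType) (beta : R).
Local Notation V := 'rV[R]_3.

Definition shell (j : nat) : set V :=
  [set x | 2 ^- j <= cyl_radius x < 2 ^- j.-1 /\
           0 < x 0 2 < 2 `^ (- (beta * j.-1%:R))].
Definition Dstar : set V := \bigcup_(j in [set j | (1 <= j)%N]) shell j.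

End Domain.

(* Main.v *)
Require Import Defs.
From HB Require Import structures.
From mathcomp Require Import all_boot all_order all_algebra.
From mathcomp Require Import all_classical all_reals all_analysis.
From mathcomp Require Import ring lra ess_sup_inf hoelder measurable_realfun.
Import Order.TTheory GRing.Theory Num.Theory.
Import numFieldNormedType.Exports.
Local Open Scope classical_set_scope.
Local Open Scope ring_scope.

(** Off the axis, v is eta(t) times the planar vortex w = (- x_1, x_0, 0) / r^2,
    which is locally the gradient of the polar angle: w is curl free, divergence
    free and harmonic.  The viscous term therefore vanishes, the convective term
    is the gradient of |v|^2 / 2 and is balanced by the pressure
    - eta^2 / (2 r^2), and the system reduces to - d_t v = f.  These identities
    are read off closed formulas for the first and second derivatives of w
    (vortex_solves).

    At a smooth boundary point off the axis, curl v = 0, so only v . n = 0 needs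
    an argument: v is azimuthal, while the normal to a domain of revolution has
    no azimuthal component, because rotating a boundary point never leads into
    the interior (outward_normal_azimuth).  The field is singular on the axis,
    so one also has to know that the tip of the cusp is not a smooth boundary
    point: a defining function would have a descent direction at the tip that
    points along the axis or downwards, where the cone 0 < x_2 < 2 r that
    contains the domain has no points (outward_normal_off_axis).

    The quantities to be integrated are |v|^2 = eta^2 / r^2,
    |grad v|^2 = 2 eta^2 / r^4 and |f|^2 = eta'^2 / r^2.  As r < 1 on the domain,
    it suffices that r^-4 is integrable (Dstar_integral_lty): the shell
    2^-(j+1) <= r < 2^-j has volume at most 4 * 2^-((2 + beta) j), so the
    integral is dominated by a geometric series of ratio 2^(2 - beta), which is
    less than 1 exactly because beta > 2.  The exponent 2 > 3/2 then serves for
    the force.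

    The weak gradient is the classical one (classical_weak_partial).  A test
    function phi is supported in a compact subset of the interior, hence away
    from the axis, so that w phi is a compactly supported function on the whole
    space with a continuous partial derivative, and the integral of the latter
    vanishes by Fubini and the fundamental theorem of calculus
    (integral_partial_eq0).

    Since eta is smooth only on the half line, it is replaced by the function
    t |-> eta (max 0 t), which is continuous on the whole line
    (clamp_continuous); joint continuity, measurability and bounds on [0, T] are
    all deduced from it. *)

(** * Time derivatives on the closed half line *)

Section Time.
Variable R : realType.
Implicit Types (f : R -> R) (t : R).

Lemma time_increments_proper t : 0 <= t -> ProperFilter (time_increments t).
Proof.
move=> t0; apply: Build_ProperFilter_ex => A.
rewrite /time_increments /within /= => /nbhs_ballP[e /= e0 be].
exists (e / 2); apply: be.
- rewrite /ball/= sub0r normrN ger0_norm ?ltr_pdivrMr//; lra.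
- by rewrite gt_eqF// divr_gt0.
- by rewrite /= addr_ge0// ltW// divr_gt0.
Qed.

(** The increment is h times a convergent difference quotient. *)
Lemma time_derivable_cvg f t : time_derivable f t ->
  f (t + h) - f t @[h --> time_increments t] --> 0.
Proof.
move=> dft.
have FF : Filter (time_increments t) by apply: within_filter.
have h0 : h @[h --> time_increments t] --> (0 : R).
  apply: cvg_trans; [apply: cvg_app; exact: cvg_within|exact: cvg_within].
have H : h * time_quotient f t h @[h --> time_increments t] -->
    (0 : R) * time_derive f t.
  by apply: cvgM => //.
rewrite mul0r in H; apply: cvg_trans H.
apply: near_eq_cvg.
rewrite /time_increments; near=> h.
rewrite /time_quotient mulrA divff ?mul1r//.
near: h; rewrite near_withinE; near=> h => _.
by near: h; exact: nbhs_dnbhs_neq.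
Unshelve. all: by end_near. Qed.

(** Extending f by the constant f 0 to negative times turns one-sided
    continuity into continuity on the line; |max 0 s - max 0 t| <= |s - t|
    transports the neighbourhoods. *)
Lemma clamp_continuous f : (forall t, 0 <= t -> time_derivable f t) ->
  continuous (fun t => f (Num.max 0 t)).
Proof.
move=> df t; set a := Num.max 0 t.
have a0 : 0 <= a by rewrite le_max lexx.
have FF := time_increments_proper a a0.
apply/(@cvgrPdist_lt _ R^o) => e e0.
have /(@cvgrPdist_lt _ R^o) /(_ e e0) := time_derivable_cvg f a (df a a0).
rewrite /time_increments near_withinE => /nbhs_ballP[d /= d0 bd].
near=> s.
have /= sd : `|Num.max 0 s - a| < d.
  have H : `|t - s| < d by near: s; apply: (@nbhsx_ballx R R^o).
  rewrite /a /Num.max; move: H; rewrite !ltr_norml.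
  by case: ifPn => ?; case: ifPn => ?; lra.
have [->|sa] := eqVneq (Num.max 0 s) a; first by rewrite subrr normr0.
have := bd (Num.max 0 s - a).
rewrite /ball/= sub0r normrN => /(_ sd).
rewrite subr_eq0 => /(_ sa); rewrite subrKC sub0r normrN distrC.
by apply; rewrite le_max lexx.
Unshelve. all: by end_near. Qed.

Lemma time_deriveMr f t (c : R) : 0 <= t -> time_derivable f t ->
  time_derivable (fun s => f s * c) t /\
  time_derive (fun s => f s * c) t = time_derive f t * c.
Proof.
move=> t0 dft; have FF := time_increments_proper t t0.
have E : time_quotient (fun s => f s * c) t = (fun h => time_quotient f t h * c).
  by apply/funext => h; rewrite /time_quotient -mulrBl mulrA.
have H : time_quotient f t h * c @[h --> time_increments t] -->
    time_derive f t * c by apply: cvgM => //; exact: cvg_cst.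
rewrite /time_derivable E; split.
  by apply/cvg_ex; eexists; exact: H.
rewrite {1}/time_derive E; apply: cvg_lim => //; exact: norm_hausdorff.
Qed.

End Time.

(** * The planar vortex and its derivatives *)

Lemma forall_I3 (P : 'I_3 -> Prop) : P 0 -> P 1 -> P 2 -> forall i, P i.
Proof.
move=> P0 P1 P2 [[|[|[|//]]] ip].
- by rewrite (_ : Ordinal _ = 0) //; exact: val_inj.
- by rewrite (_ : Ordinal _ = 1) //; exact: val_inj.
- by rewrite (_ : Ordinal _ = 2) //; exact: val_inj.
Qed.

Lemma sum_I3 (U : nmodType) (F : 'I_3 -> U) : \sum_i F i = F 0 + F 1 + F 2.
Proof.
rewrite !big_ord_recl big_ord0 addr0 addrA.
by congr (F _ + F _ + F _); exact: val_inj.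
Qed.

Section Vortex.
Variable R : realType.
Local Notation V := 'rV[R]_3.
Implicit Types x y v : V.

Lemma vec3E (a b c : R) :
  (vec3 a b c 0 0 = a) * (vec3 a b c 0 1 = b) * (vec3 a b c 0 2 = c).
Proof. by rewrite !mxE. Qed.

Lemma vec3_eta x : vec3 (x 0 0) (x 0 1) (x 0 2) = x.
Proof. by apply/rowP; apply: forall_I3; rewrite mxE. Qed.

Definition rad2 x : R := x 0 0 ^+ 2 + x 0 1 ^+ 2.

Lemma rad2_ge0 x : 0 <= rad2 x.
Proof. by rewrite addr_ge0 // sqr_ge0. Qed.

Lemma cyl_radius_sqr x : cyl_radius x ^+ 2 = rad2 x.
Proof. by rewrite sqr_sqrtr // rad2_ge0. Qed.

Definition inv_rad2 x : R := (rad2 x)^-1.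
Definition vortex x : V := inv_rad2 x *: vec3 (- x 0 1) (x 0 0) 0.

(** Division by zero being zero, the identity also holds on the axis, so that
    the velocity is everywhere equal to a multiple of the vortex. *)
Lemma vortexE a x : (a / cyl_radius x) *: e_theta x = a *: vortex x.
Proof.
rewrite /vortex /e_theta /inv_rad2 -cyl_radius_sqr scalerA.
by apply/rowP; apply: forall_I3; rewrite !mxE /=; rewrite ?mulr0 // -exprVn expr2; ring.
Qed.

(** The nonzero entries of the gradient of the vortex: grad_a is the mixed
    derivative d_1 w_0 = d_0 w_1 (equal since w is curl free), and
    grad_b = d_0 w_0 = - d_1 w_1 (as w is divergence free).  Since w is
    harmonic, grad_a and grad_b satisfy Cauchy-Riemann equations too, and
    hess_a = d_0 grad_b = - d_1 grad_a, hess_b = d_0 grad_a = d_1 grad_b. *)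
Definition grad_a x := (x 0 1 ^+ 2 - x 0 0 ^+ 2) * inv_rad2 x ^+ 2.
Definition grad_b x := 2 * x 0 0 * x 0 1 * inv_rad2 x ^+ 2.
Definition hess_a x := 2 * x 0 1 * (x 0 1 ^+ 2 - 3 * x 0 0 ^+ 2) * inv_rad2 x ^+ 3.
Definition hess_b x := 2 * x 0 0 * (x 0 0 ^+ 2 - 3 * x 0 1 ^+ 2) * inv_rad2 x ^+ 3.

(** Symmetric and traceless: the shape common to the gradient of the vortex and
    to the derivatives of this gradient. *)
Definition planar_mx (a b : R) : 'M[R]_3 :=
  \matrix_(i, j) (nth [::] [:: [:: b; a; 0]; [:: a; - b; 0]; [:: 0; 0; 0]] i)`_j.

Definition vortex_grad x := planar_mx (grad_a x) (grad_b x).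
Definition vortex_hess x (k : 'I_3) :=
  planar_mx ([:: hess_b x; - hess_a x; 0]`_k) ([:: hess_a x; hess_b x; 0]`_k).

Lemma is_derive_coord (k : 'I_3) x v :
  is_derive x v (fun y : V => y 0 k) (v 0 k).
Proof.
have d : differentiable (fun y : V => y 0 k) x by exact: differentiable_coord.
apply: DeriveDef; first exact: diff_derivable.
rewrite deriveE //.
have @f : {linear V -> R}.
  by exists (fun N : V => N 0 k); do 2![eexists]; do ?[constructor];
     rewrite ?mxE// => ? *; rewrite ?mxE//; move=> ?; rewrite !mxE.
rewrite (_ : (fun y : V => y 0 k) = f) // diff_lin //.
exact: coord_continuous.
Qed.

Lemma rad2_fctE : rad2 = (fun y : V => y 0 0) ^+ 2 + (fun y : V => y 0 1) ^+ 2.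
Proof. by []. Qed.

Lemma differentiable_rad2 x : differentiable rad2 x.
Proof.
rewrite rad2_fctE.
by apply: differentiableD; apply: differentiableX; exact: differentiable_coord.
Qed.

Lemma is_derive_rad2 x v :
  is_derive x v rad2 (2 * (x 0 0 * v 0 0 + x 0 1 * v 0 1)).
Proof.
have d (k : 'I_3) := is_deriveX 2 (is_derive_coord k x v).
rewrite rad2_fctE; apply: is_derive_eq (is_deriveD (d 0) (d 1)) _.
by rewrite /GRing.scale/=; ring.
Qed.

(** The pointwise formulas are rewritten as ring expressions between functions,
    the form to which the rules of differentiation apply. *)
Lemma vortex0E : component vortex 0 = - (inv_rad2 * (fun y => y 0 1)).
Proof. by apply/funext=> y; rewrite /component !mxE /= mulrN. Qed.

Lemma vortex1E : component vortex 1 = inv_rad2 * (fun y => y 0 0).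
Proof. by apply/funext=> y; rewrite /component !mxE. Qed.

Lemma vortex2E : component vortex 2 = cst 0.
Proof. by apply/funext=> y; rewrite /component !mxE /= mulr0. Qed.

Lemma grad_a_fctE : grad_a =
  ((fun y : V => y 0 1) ^+ 2 - (fun y : V => y 0 0) ^+ 2) * inv_rad2 ^+ 2.
Proof. by []. Qed.

Lemma grad_b_fctE : grad_b =
  2 \*: ((fun y : V => y 0 0) * (fun y : V => y 0 1) * inv_rad2 ^+ 2).
Proof. by apply/funext => y; rewrite /grad_b -!mulrA. Qed.

Lemma hess_a_fctE : hess_a =
  2 \*: ((fun y : V => y 0 1) *
    ((fun y : V => y 0 1) ^+ 2 - 3 \*: (fun y : V => y 0 0) ^+ 2) * inv_rad2 ^+ 3).
Proof. by apply/funext => y; rewrite /hess_a -!mulrA. Qed.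

Lemma hess_b_fctE : hess_b =
  2 \*: ((fun y : V => y 0 0) *
    ((fun y : V => y 0 0) ^+ 2 - 3 \*: (fun y : V => y 0 1) ^+ 2) * inv_rad2 ^+ 3).
Proof. by apply/funext => y; rewrite /hess_b -!mulrA. Qed.

Section OffAxis.
Variable x : V.
Hypothesis x0 : rad2 x != 0.

Lemma differentiable_inv_rad2 : differentiable inv_rad2 x.
Proof. by apply: differentiableV => //; exact: differentiable_rad2. Qed.

Lemma is_derive_inv_rad2 v : is_derive x v inv_rad2
  (- inv_rad2 x ^+ 2 * (2 * (x 0 0 * v 0 0 + x 0 1 * v 0 1))).
Proof.
have d := is_derive_rad2 x v.
apply: DeriveDef; first exact: derivableV.
by rewrite deriveV // derive_val /inv_rad2 exprVn.
Qed.
Local Existing Instance is_derive_inv_rad2.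
Local Existing Instance is_derive_coord.

Lemma is_derive_vortex v i :
  is_derive x v (component vortex i) (\sum_j v 0 j * vortex_grad x i j).
Proof.
have xx : (x 0 0) ^+ 2 + (x 0 1) ^+ 2 != 0 by [].
rewrite sum_I3.
move: i; apply: forall_I3.
- rewrite vortex0E.
  apply: is_derive_eq; rewrite !mxE /= /grad_a /grad_b /inv_rad2 /rad2 /GRing.scale/=.
  by field.
- rewrite vortex1E.
  apply: is_derive_eq; rewrite !mxE /= /grad_a /grad_b /inv_rad2 /rad2 /GRing.scale/=.
  by field.
- rewrite vortex2E.
  by apply: is_derive_eq; rewrite !mxE /=; ring.
Qed.

Lemma is_derive_grad_a v :
  is_derive x v grad_a (v 0 0 * hess_b x - v 0 1 * hess_a x).
Proof.
have xx : (x 0 0) ^+ 2 + (x 0 1) ^+ 2 != 0 by [].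
rewrite grad_a_fctE.
apply: is_derive_eq; rewrite /GRing.scale/= /hess_a /hess_b /inv_rad2 /rad2.
have -> : ((fun y : V => y 0 1) ^+ 2 - (fun y : V => y 0 0) ^+ 2) x =
    x 0 1 ^+ 2 - x 0 0 ^+ 2 by [].
have -> : ((fun y : V => (rad2 y)^-1) ^+ 2) x = (rad2 x)^-1 ^+ 2 by [].
by rewrite /rad2; field.
Qed.

Lemma is_derive_grad_b v :
  is_derive x v grad_b (v 0 0 * hess_a x + v 0 1 * hess_b x).
Proof.
have xx : (x 0 0) ^+ 2 + (x 0 1) ^+ 2 != 0 by [].
rewrite grad_b_fctE.
apply: is_derive_eq; rewrite /GRing.scale/= /hess_a /hess_b.
have -> : (inv_rad2 ^+ 2) x = (rad2 x)^-1 ^+ 2 by [].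
have -> : ((fun y : V => y 0 0) * (fun y : V => y 0 1)) x = x 0 0 * x 0 1 by [].
by rewrite /inv_rad2 /rad2; field.
Qed.

Lemma differentiable_grad_a : differentiable grad_a x.
Proof.
rewrite grad_a_fctE; have dS := differentiable_inv_rad2.
apply: differentiableM; last exact: differentiableX.
by apply: differentiableB; apply: differentiableX; exact: differentiable_coord.
Qed.

Lemma differentiable_grad_b : differentiable grad_b x.
Proof.
rewrite grad_b_fctE; have dS := differentiable_inv_rad2.
apply: differentiableZ; apply: differentiableM; last exact: differentiableX.
by apply: differentiableM; exact: differentiable_coord.
Qed.

Lemma differentiable_hess_a : differentiable hess_a x.
Proof.
rewrite hess_a_fctE; have dS := differentiable_inv_rad2.
have dX k : differentiable (fun y : V => y 0 k) x by exact: differentiable_coord.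
apply: differentiableZ; apply: differentiableM; last exact: differentiableX.
apply: differentiableM => //.
by apply: differentiableB; last apply: differentiableZ; exact: differentiableX.
Qed.

Lemma differentiable_hess_b : differentiable hess_b x.
Proof.
rewrite hess_b_fctE; have dS := differentiable_inv_rad2.
have dX k : differentiable (fun y : V => y 0 k) x by exact: differentiable_coord.
apply: differentiableZ; apply: differentiableM; last exact: differentiableX.
apply: differentiableM => //.
by apply: differentiableB; last apply: differentiableZ; exact: differentiableX.
Qed.

Lemma differentiable_vortex_component i : differentiable (component vortex i) x.
Proof.
have dS := differentiable_inv_rad2.
have dX k : differentiable (fun y : V => y 0 k) x by exact: differentiable_coord.
move: i; apply: forall_I3.
- rewrite vortex0E; apply: differentiableN; exact: differentiableM.
- rewrite vortex1E; exact: differentiableM.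
- rewrite vortex2E; exact: differentiable_cst.
Qed.

Lemma differentiable_planar_mx (a b : V -> R) i j :
  differentiable a x -> differentiable b x ->
  differentiable (fun y => planar_mx (a y) (b y) i j) x.
Proof.
move=> da db; under eq_fun do rewrite mxE.
by move: i; apply: forall_I3; move: j; apply: forall_I3 => //=;
  (exact: differentiableN || exact: differentiable_cst).
Qed.

Lemma differentiable_vortex_grad i j :
  differentiable (fun y => vortex_grad y i j) x.
Proof.
apply: differentiable_planar_mx; first exact: differentiable_grad_a.
exact: differentiable_grad_b.
Qed.

Lemma differentiable_vortex_hess k i j :
  differentiable (fun y => vortex_hess y k i j) x.
Proof.
have da := differentiable_hess_a; have db := differentiable_hess_b.
move: k; apply: forall_I3; apply: differentiable_planar_mx => //=.
exact: differentiableN.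
Qed.

Lemma is_derive_velocity a v i :
  is_derive x v (component (fun y => a *: vortex y) i)
    (a * \sum_j v 0 j * vortex_grad x i j).
Proof.
have d := is_derive_vortex v i.
have -> : component (fun y => a *: vortex y) i = a \*: component vortex i.
  by apply/funext => y; rewrite /component mxE.
exact: is_deriveZ.
Qed.

Lemma ebaseE (j k : 'I_3) : ebase R j 0 k = (j == k)%:R.
Proof. by rewrite mxE eqxx eq_sym. Qed.

Lemma sum_ebase (F : 'I_3 -> R) j : \sum_k ebase R j 0 k * F k = F j.
Proof.
rewrite (bigD1 j) //= ebaseE eqxx mul1r big1 ?addr0 // => k.
by rewrite ebaseE eq_sym => /negPf->; rewrite mul0r.
Qed.

Lemma partial_velocity a i j :
  partial j (component (fun y => a *: vortex y) i) x = a * vortex_grad x i j.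
Proof.
have d := is_derive_velocity a (ebase R j) i.
by rewrite /partial derive_val sum_ebase.
Qed.

Lemma is_derive_vortex_grad k i j :
  is_derive x (ebase R k) (fun y => vortex_grad y i j) (vortex_hess x k i j).
Proof.
have da := is_derive_grad_a (ebase R k).
have db := is_derive_grad_b (ebase R k).
rewrite /vortex_hess mxE.
under eq_fun do rewrite mxE.
move: k i j da db; apply: forall_I3;
  rewrite !ebaseE !(eqxx, mul1r, mul0r, addr0, add0r, subr0) /= ?sub0r => i j.
all: move: i; apply: forall_I3; move: j; apply: forall_I3 => //= da db.
all: try by apply: is_derive_eq; rewrite ?oppr0.
all: try exact: is_deriveN.
all: try exact: is_derive_cst.
Qed.

End OffAxis.

Lemma near_off_axis x : rad2 x != 0 -> \forall y \near x, rad2 y != 0.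
Proof.
move=> x0.
have c := differentiable_continuous (differentiable_rad2 x).
have n0 : nbhs (rad2 x) (fun u => u != 0).
  by apply: open_nbhs_nbhs; split => //; exact: open_neq.
exact: c n0.
Qed.
End Vortex.
Arguments rad2 {R}.
Arguments inv_rad2 {R}.
Arguments vortex {R}.
Arguments vortex_grad {R}.
Arguments vortex_hess {R}.

(** * The Navier-Stokes system *)

Section NS.
Variable R : realType.
Local Notation V := 'rV[R]_3.
Implicit Types x y v : V.

(** The formula for the first derivative holds on a neighbourhood of x, because
    being off the axis is an open condition, and may be differentiated. *)
Lemma partial_partial_velocity (a : R) x i j k : rad2 x != 0 ->
  derivable (partial j (component (fun y => a *: vortex y) i)) x (ebase R k) /\
  partial k (partial j (component (fun y => a *: vortex y) i)) x =
    a * vortex_hess x k i j.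
Proof.
move=> x0.
have d : is_derive x (ebase R k)
    (partial j (component (fun y => a *: vortex y) i)) (a * vortex_hess x k i j).
  have dG := is_derive_vortex_grad R x x0 k i j.
  apply: (@near_eq_is_derive _ _ _ (a \*: (fun y => vortex_grad y i j))).
    by near=> y; rewrite partial_velocity //; near: y; exact: near_off_axis.
by split => //; rewrite /partial derive_val.
Unshelve. all: by end_near. Qed.

(** Every field of the problem separates as a function of time times a function
    of space; on the cylinder it agrees with a product that is continuous at each
    point of the whole space. *)
Lemma separated_continuous_on_cylinder (D : set V) (g : R -> V -> R)
    (e : R -> R) (h : V -> R) :
  continuous (fun t : R => e (Num.max 0 t)) ->
  (forall x, D x -> differentiable h x) ->
  (forall t x, 0 <= t -> D x -> g t x = e t * h x) ->
  continuous_on_cylinder D g.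
Proof.
move=> ce dh gE; apply/subspace_continuousP => -[t x] [/= t0 Dx].
rewrite [X in _ --> X](gE t x t0 Dx).
have -> : e t = e (Num.max 0 t) by rewrite max_r.
pose k (z : R * V) := e (Num.max 0 z.1) * h z.2.
suff ck : {for (t, x), continuous k}.
  have ck' : k @ within [set z : R * V | 0 <= z.1 /\ D z.2] (nbhs (t, x)) --> k (t, x).
    by apply: cvg_trans ck; apply: cvg_app; exact: cvg_within.
  apply: cvg_trans ck'; apply: near_eq_cvg; rewrite near_withinE.
  by apply: nearW => -[s y] /= [s0 Dy]; rewrite /k /= max_r //; apply: esym; exact: gE.
have cfst : {for (t, x), continuous (@fst R V)} by exact: cvg_fst.
have csnd : {for (t, x), continuous (@snd R V)} by exact: cvg_snd.
have ch : {for x, continuous h} by exact/differentiable_continuous/dh.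
have c1 := @continuous_comp (R * V)%type R R fst _ (t, x) cfst (ce t).
have c2 := @continuous_comp (R * V)%type V R snd h (t, x) csnd ch.
exact: (continuousM c1 c2).
Qed.

Variable D : set V.
Hypothesis D_off_axis : forall x, D x -> rad2 x != 0.
Variable eta : R -> R.
Hypothesis eta_smooth : time_smooth eta.

Let clamp_eta : continuous (fun t : R => eta (Num.max 0 t)).
Proof. by apply: clamp_continuous => t; exact: eta_smooth 0%N t. Qed.

Lemma time_derive_clamp_continuous :
  continuous (fun t : R => time_derive eta (Num.max 0 t)).
Proof. by apply: clamp_continuous => t; exact: eta_smooth 1%N t. Qed.

Let v t x := eta t *: vortex x.

Lemma time_partial_velocity t x : 0 <= t ->
  time_partial v t x = time_derive eta t *: vortex x.
Proof.
move=> t0; apply/rowP => i; rewrite mxE [RHS]mxE.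
have -> : (fun s => v s x 0 i) = (fun s => eta s * vortex x 0 i).
  by apply/funext => s; rewrite /v mxE.
by have [] := time_deriveMr R eta t (vortex x 0 i) t0 (eta_smooth 0%N t t0).
Qed.

Lemma regular_velocity_vortex : regular_velocity D v.
Proof.
split.
- move=> t x i t0 Dx; have x0 := D_off_axis _ Dx; split.
  + have -> : (fun s => v s x 0 i) = (fun s => eta s * vortex x 0 i).
      by apply/funext => s; rewrite /v mxE.
    by have [] := time_deriveMr R eta t (vortex x 0 i) t0 (eta_smooth 0%N t t0).
  + by move=> j; have [] := is_derive_velocity R x x0 (eta t) (ebase R j) i.
  + by move=> j k; have [] := partial_partial_velocity (eta t) x i j k x0.
- move=> i; apply: (separated_continuous_on_cylinder _ _ eta (component vortex i)) => //.
    by move=> x /D_off_axis x0; exact: differentiable_vortex_component.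
  by move=> t x _ _; rewrite /component mxE.
- move=> i j; apply: (separated_continuous_on_cylinder _ _ eta
    (fun x => vortex_grad x i j)) => //.
    by move=> x /D_off_axis x0; exact: differentiable_vortex_grad.
  by move=> t x _ /D_off_axis x0; rewrite partial_velocity.
- move=> i j k; apply: (separated_continuous_on_cylinder _ _ eta
    (fun x => vortex_hess x k i j)) => //.
    by move=> x /D_off_axis x0; exact: differentiable_vortex_hess.
  by move=> t x _ /D_off_axis x0; have [] := partial_partial_velocity (eta t) x i j k x0.
- move=> i; apply: (separated_continuous_on_cylinder _ _ (time_derive eta)
    (component vortex i)).
  + exact: time_derive_clamp_continuous.
  + by move=> x /D_off_axis x0; exact: differentiable_vortex_component.
  + by move=> t x t0 _; rewrite time_partial_velocity // mxE.
Qed.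

(** Bernoulli: minus half the square of the speed. *)
Definition pressure t x := - 2^-1 * eta t ^+ 2 * inv_rad2 x.

Lemma is_derive_pressure t x j : rad2 x != 0 ->
  is_derive x (ebase R j) (pressure t)
    (eta t ^+ 2 * (inv_rad2 x ^+ 2 * [:: x 0 0; x 0 1; 0]`_j)).
Proof.
move=> x0; have d := is_derive_inv_rad2 R x x0 (ebase R j).
have -> : pressure t = (- 2^-1 * eta t ^+ 2) \*: inv_rad2 by [].
apply: is_derive_eq; rewrite /GRing.scale /= !ebaseE.
by move: j {d}; apply: forall_I3; rewrite /= !(mulr1n,mulr0n); field.
Qed.

Lemma partial_pressure t x j : rad2 x != 0 ->
  partial j (pressure t) x = eta t ^+ 2 * (inv_rad2 x ^+ 2 * [:: x 0 0; x 0 1; 0]`_j).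
Proof.
by move=> x0; have d := is_derive_pressure t x j x0; rewrite /partial derive_val.
Qed.

Lemma regular_pressure_vortex : regular_pressure D pressure.
Proof.
have c2 : continuous (fun t : R => eta (Num.max 0 t) ^+ 2).
  move=> t.
  exact: (@continuous_comp R R R (fun t => eta (Num.max 0 t)) (fun u => u ^+ 2) t
    (clamp_eta t) (@exprn_continuous R 2 _)).
split.
- by move=> t x j _ /D_off_axis x0; have [] := is_derive_pressure t x j x0.
- apply: (separated_continuous_on_cylinder _ _ (fun t => eta t ^+ 2)
    ((- 2^-1) \*: inv_rad2)) => //.
    by move=> x /D_off_axis x0; apply: differentiableZ; exact: differentiable_inv_rad2.
  move=> t x _ _; rewrite /pressure /=.
  by rewrite (_ : - 2^-1 *: inv_rad2 x = - 2^-1 * inv_rad2 x) //; ring.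
- move=> j; pose h x := inv_rad2 x ^+ 2 * [:: x 0 0; x 0 1; 0]`_j.
  apply: (separated_continuous_on_cylinder _ _ (fun t => eta t ^+ 2) h) => //.
    move=> x /D_off_axis x0.
    have -> : h = inv_rad2 ^+ 2 * (fun x => [:: x 0 0; x 0 1; 0]`_j) by [].
    apply: differentiableM.
      by apply: differentiableX; exact: differentiable_inv_rad2.
    by move: j {h}; apply: forall_I3 => /=;
      (exact: differentiable_cst || exact: differentiable_coord).
  by move=> t x _ /D_off_axis x0; rewrite partial_pressure.
Qed.

Lemma vortex_solves : navier_stokes_solution D
  (fun t x => - (time_derive eta t *: vortex x)) v pressure.
Proof.
split; [exact: regular_velocity_vortex|exact: regular_pressure_vortex|].
move=> t x t0 Dx; have x0 := D_off_axis _ Dx.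
have xx : (x 0 0) ^+ 2 + (x 0 1) ^+ 2 != 0 by [].
rewrite time_partial_velocity //; split.
  (* the time derivative is the force, the other terms cancel *)
  rewrite -[RHS]add0r; congr (_ - _).
  apply/rowP => i; rewrite !mxE !sum_I3.
  rewrite !(fun j => (partial_partial_velocity (eta t) x i j j x0).2).
  rewrite !partial_velocity // partial_pressure // !mxE.
  move: i; apply: forall_I3; rewrite /= /grad_a /grad_b /hess_a /hess_b /inv_rad2 /rad2;
  by field.
rewrite /divergence sum_I3 !partial_velocity // !mxE /=; ring.
Qed.
End NS.
Arguments pressure {R}.

(** * Smooth boundary points of a domain of revolution *)

Section Boundary.
Variable R : realType.
Local Notation V := 'rV[R]_3.
Implicit Types x y u : V.

Lemma is_derive_neg_near (F : R -> R) (d : R) :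
  is_derive (0 : R) (1 : R) F d -> d < 0 -> \forall s \near 0^'+, F s < F 0.
Proof.
move=> [dF dE] d0.
have H : (fun h => h^-1 *: ((F \o shift 0) (h *: (1:R)) - F 0)) @ 0^' --> d.
  by rewrite -dE; exact: dF.
have H' : \forall h \near 0^', h^-1 *: ((F \o shift 0) (h *: (1:R)) - F 0) < 0.
  exact: (cvgr_lt d H).
have H2 : \forall h \near 0^'+, h^-1 *: ((F \o shift 0) (h *: (1:R)) - F 0) < 0.
  move: H'; rewrite /at_right !near_withinE; apply: filterS => h + h0.
  by apply; rewrite gt_eqF.
near=> s.
have s0 : 0 < s by [].
have : s^-1 *: ((F \o shift 0) (s *: (1:R)) - F 0) < 0 by near: s.
by rewrite /= addr0 /GRing.scale /= mulr1 pmulr_rlt0 ?invr_gt0 // subr_lt0.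
Unshelve. all: by end_near. Qed.

Lemma derive_grad (rho : V -> R) x u : differentiable rho x ->
  'd rho x u = dotv (grad rho x) u.
Proof.
move=> d.
have {1}-> : u = \sum_i u 0 i *: ebase R i by exact: row_sum_delta.
rewrite linear_sum; apply: eq_bigr => i _.
by rewrite linearZ mxE /partial deriveE // /GRing.scale /= mulrC.
Qed.

Lemma is_derive_curve (rho : V -> R) (c : R -> V) u :
  differentiable rho (c 0) -> is_derive (0 : R) (1 : R) c u ->
  is_derive (0 : R) (1 : R) (rho \o c) (dotv (grad rho (c 0)) u).
Proof.
move=> drho [dc cu].
have /derivable1_diffP dc' := dc.
have d : differentiable (rho \o c) 0 by exact: differentiable_comp.
apply: DeriveDef; first exact/derivable1_diffP.
by rewrite deriveE // diff_comp //= -derive_grad // -cu deriveE.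
Qed.

Lemma is_derive_line x u (s0 : R) :
  is_derive s0 (1 : R) (fun s : R => x + s *: u) u.
Proof.
have d : is_derive s0 (1 : R) (fun s : R => s *: u) u.
  have H := @is_diff_scalel R V s0 u.
  apply: DeriveDef; first by apply: diff_derivable; exact: ex_diff.
  by rewrite deriveE ?diff_val ?scale1r //; exact: ex_diff.
by apply: is_derive_eq; rewrite add0r.
Qed.

Definition rotate (c s : R) x : V :=
  vec3 (c * x 0 0 - s * x 0 1) (s * x 0 0 + c * x 0 1) (x 0 2).

(** The factor e = 1 or e = - 1 gives the rotations in both directions. *)
Lemma is_derive_rotate x (e : R) :
  is_derive (0 : R) (1 : R) (fun s : R => rotate (cos (e * s)) (sin (e * s)) x)
     (vec3 (- e * x 0 1) (e * x 0 0) 0).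
Proof.
have d1 : is_derive (0:R) (1:R) (e \*: (@id R)) e.
  by apply: is_derive_eq; rewrite /GRing.scale /= mulr1.
have e0 : (e \*: (@id R)) 0 = 0 by exact: mulr0.
have dcos : is_derive (0:R) (1:R) (fun s : R => cos (e * s)) 0.
  have := is_derive1_comp (is_derive_cos ((e \*: (@id R)) 0)) d1.
  by rewrite e0 sin0 oppr0 mul0r.
have dsin : is_derive (0:R) (1:R) (fun s : R => sin (e * s)) e.
  have := is_derive1_comp (is_derive_sin ((e \*: (@id R)) 0)) d1.
  by rewrite e0 cos0 mul1r.
pose f (k : 'I_3) (s : R) := rotate (cos (e * s)) (sin (e * s)) x 0 k.
have df k : is_derive (0:R) (1:R) (f k) (vec3 (- e * x 0 1) (e * x 0 0) 0 0 k).
  rewrite /f; move: k; apply: forall_I3.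
  - have -> : (fun s => rotate (cos (e * s)) (sin (e * s)) x 0 0) =
        (x 0 0 \*: (fun s => cos (e * s))) - (x 0 1 \*: (fun s => sin (e * s))).
      by apply/funext => s; rewrite mxE /= mulrC [sin _ * _]mulrC.
    by apply: is_derive_eq; rewrite mxE /= scaler0 sub0r /GRing.scale /= mulNr mulrC.
  - have -> : (fun s => rotate (cos (e * s)) (sin (e * s)) x 0 1) =
        (x 0 0 \*: (fun s => sin (e * s))) + (x 0 1 \*: (fun s => cos (e * s))).
      by apply/funext => s; rewrite mxE /= mulrC [cos _ * _]mulrC.
    by apply: is_derive_eq; rewrite mxE /= scaler0 addr0 /GRing.scale /= mulrC.
  - have -> : (fun s => rotate (cos (e * s)) (sin (e * s)) x 0 2) = cst (x 0 2).
      by apply/funext => s; rewrite mxE.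
    by apply: is_derive_eq; rewrite mxE.
have dM : derivable (fun s : R => rotate (cos (e * s)) (sin (e * s)) x) (0:R) (1:R).
  by apply/derivable_mxP => i k; rewrite (ord1 i); have [] := df k.
apply: DeriveDef => //; rewrite derive_mx //; apply/rowP => k; rewrite mxE.
by have [_ ->] := df k.
Qed.

Lemma rotate_radius c s x : c ^+ 2 + s ^+ 2 = 1 ->
  cyl_radius (rotate c s x) = cyl_radius x.
Proof.
move=> cs; rewrite /cyl_radius /rotate !vec3E; congr (Num.sqrt _).
transitivity ((c ^+ 2 + s ^+ 2) * (x 0 0 ^+ 2 + x 0 1 ^+ 2)); first ring.
by rewrite cs mul1r.
Qed.

Lemma rotate_cos0 x : rotate (cos 0) (sin 0) x = x.
Proof.
by rewrite cos0 sin0 -[RHS]vec3_eta /rotate !(mul1r, mul0r) subr0 add0r.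
Qed.

(** A vector field is the sum of its components times the basis vectors. *)
Lemma differentiable_row (f : V -> V) x :
  (forall i, differentiable (component f i) x) -> differentiable f x.
Proof.
move=> df.
have -> : f = \sum_i (fun y => component f i y *: ebase R i).
  by apply/funext => y; rewrite fct_sumE; exact: row_sum_delta.
by apply: differentiable_sum => i; exact: differentiableZl.
Qed.

Lemma rotate_continuous c s : continuous (rotate c s).
Proof.
move=> x; apply: differentiable_continuous; apply: differentiable_row.
have d (k : 'I_3) a : differentiable (a \*: (fun y : V => y 0 k)) x.
  by apply: differentiableZ; exact: differentiable_coord.
apply: forall_I3.
- have -> : component (rotate c s) 0 =
      c \*: (fun y : V => y 0 0) - s \*: (fun y : V => y 0 1).
    by apply/funext => y; rewrite /component mxE.
  exact: differentiableB.
- have -> : component (rotate c s) 1 =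
      s \*: (fun y : V => y 0 0) + c \*: (fun y : V => y 0 1).
    by apply/funext => y; rewrite /component mxE.
  exact: differentiableD.
- have -> : component (rotate c s) 2 = (fun y : V => y 0 2).
    by apply/funext => y; rewrite /component mxE.
  exact: differentiable_coord.
Qed.

(** To first order in s, rho (c s) is s times the negative number grad rho . u. *)
Lemma descent_curve_enters D (rho : V -> R) x (c : R -> V) u :
  rho x = 0 -> differentiable rho x ->
  (\forall y \near x, D° y <-> rho y < 0) ->
  c 0 = x -> is_derive (0 : R) (1 : R) c u -> dotv (grad rho x) u < 0 ->
  \forall s \near (0 : R)^'+, D° (c s).
Proof.
move=> rho0 drho Drho c0 dc gu.
have dF : is_derive (0 : R) (1 : R) (rho \o c) (dotv (grad rho (c 0)) u).
  by apply: is_derive_curve; rewrite ?c0.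
rewrite c0 in dF.
have H1 := is_derive_neg_near _ _ dF gu; rewrite /= c0 rho0 in H1.
have cc : {for (0 : R), continuous c}.
  by apply/differentiable_continuous/derivable1_diffP; have [] := dc.
have H2 : \forall s \near (0 : R), D° (c s) <-> rho (c s) < 0.
  by rewrite /prop_for /continuous_at c0 in cc; exact: cc Drho.
have H3 : \forall s \near (0 : R)^'+, D° (c s) <-> rho (c s) < 0.
  by rewrite /at_right near_withinE; exact: filterS H2.
by apply: filterS2 H1 H3 => s h1 ->.
Qed.

Section Cone.
Variable D : set V.
Hypothesis D_cone : forall x, D x -> 0 < x 0 2 < 2 * cyl_radius x.

(** If x were on the axis, then along any descent direction of the defining
    function x would move immediately into the cone 0 < x_2 < 2 r.  But some
    descent direction does not allow this: minus the gradient if the gradient is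
    vertical, since it keeps r = 0, and otherwise a direction tilted downwards:
    it makes x_2 negative if x_2 <= 0 at the start, while if x_2 > 0 at the start
    then x_2 > 2 r for a short time. *)
Lemma outward_normal_off_axis x n : outward_normal D x n -> rad2 x != 0.
Proof.
move=> [rho [rho0 g0 drho Drho _]]; apply/negP => /eqP x0.
set g := grad rho x in g0.
have dx : differentiable rho x by have [] := nbhs_singleton drho.
have /andP[/eqP x00 /eqP x01] : (x 0 0 == 0) && (x 0 1 == 0).
  by move/eqP: x0; rewrite /rad2 paddr_eq0 ?sqr_ge0 // !sqrf_eq0.
(* moving from x along a descent direction u of rho, one is in D at once, and
   D lies in a cone around the axis *)
have key u : dotv g u < 0 -> \forall s \near (0 : R)^'+,
    0 < x 0 2 + s * u 0 2 < 2 * (s * Num.sqrt (rad2 u)).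
  move=> gu; near=> s.
  have s0 : 0 < s by [].
  have Ds : D (x + s *: u).
    apply: interior_subset; near: s.
    apply: (descent_curve_enters D rho x _ u rho0 dx) => //.
    - by apply: filterS Drho => y [].
    - by rewrite scale0r addr0.
    - exact: is_derive_line.
  have := D_cone _ Ds; rewrite !mxE /cyl_radius !mxE x00 x01 !add0r !exprMn.
  by rewrite -mulrDr sqrtrM ?sqr_ge0 // sqrtr_sqr gtr0_norm.
have gE u : dotv g u = g 0 0 * u 0 0 + g 0 1 * u 0 1 + g 0 2 * u 0 2.
  by rewrite /dotv sum_I3.
clearbody g.
have gs : 0 <= Num.sqrt (rad2 g) := sqrtr_ge0 _.
have [g_axis|g_off] := eqVneq (rad2 g) 0.
  have /andP[/eqP g00 /eqP g01] : (g 0 0 == 0) && (g 0 1 == 0).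
    by move/eqP: g_axis; rewrite /rad2 paddr_eq0 ?sqr_ge0 // !sqrf_eq0.
  have g2 : g 0 2 != 0.
    apply: contraNneq g0 => g02; apply/eqP/rowP.
    by apply: forall_I3; rewrite [RHS]mxE.
  have gu : dotv g (- g) < 0.
    by rewrite gE !mxE g00 g01 !mul0r !add0r mulrN oppr_lt0 -expr2 exprn_even_gt0.
  (* with a vertical gradient the descent direction stays on the axis *)
  have [s /= /andP[/lt_trans h /h]] :=
    @filter_ex _ _ (at_right_proper_filter (0 : R)) _ (key _ gu).
  by rewrite /rad2 !mxE g00 g01 oppr0 expr0n /= addr0 sqrtr0 !mulr0 ltxx.
have rg : 0 < rad2 g by rewrite lt_neqAle eq_sym g_off rad2_ge0.
(* otherwise tilt the horizontal descent direction downwards, by an amount k small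
   enough for the vertical part of the gradient not to matter *)
pose k := rad2 g / (1 + `|g 0 2|).
have k0 : 0 < k by rewrite divr_gt0 // ltr_wpDr.
pose u := vec3 (- g 0 0) (- g 0 1) (- k) : V.
have ru : rad2 u = rad2 g by rewrite /rad2 !vec3E !sqrrN.
have kE : k * (1 + `|g 0 2|) = rad2 g.
  by rewrite divfK // gt_eqF // ltr_wpDr.
have gu : dotv g u < 0.
  rewrite gE !vec3E.
  have -> : g 0 0 * - g 0 0 + g 0 1 * - g 0 1 + g 0 2 * - k =
      - k * (1 + `|g 0 2| + g 0 2).
    transitivity (- rad2 g - g 0 2 * k); first by rewrite /rad2; ring.
    by rewrite -kE; ring.
  rewrite mulNr oppr_lt0 mulr_gt0 // -addrA ltr_pwDl //.
  by rewrite addrC -lerBlDr sub0r lerNl -normrN ler_norm.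
have x2 : 0 < x 0 2.
  have [s [/= /andP[h1 _] s0]] := filter_ex (filterI (key u gu) (nbhs_right_gt 0)).
  apply: lt_trans h1 _; rewrite vec3E mulrN ltrBlDr ltrDl mulr_gt0 //.
have w0 : 0 < k + 2 * Num.sqrt (rad2 g) by rewrite ltr_wpDr // mulr_ge0.
(* x has positive height, so nearby points of the line are above the cone *)
have [s [/= [/andP[_ h2] s0] sx]] :=
  filter_ex (filterI (filterI (key u gu) (nbhs_right_gt 0))
   (nbhs_right_lt (divr_gt0 x2 w0))).
move: h2 sx; rewrite ru vec3E ltr_pdivlMr //.
by set w := Num.sqrt _; set z := x 0 2; nra.
Unshelve. all: by end_near. Qed.
End Cone.

Section Revolution.
Variable D : set V.
Hypothesis D_revolution : forall x y, D x -> cyl_radius y = cyl_radius x ->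
  y 0 2 = x 0 2 -> D y.

Lemma interior_rotate c s x : c ^+ 2 + s ^+ 2 = 1 ->
  D° (rotate c s x) -> D° x.
Proof.
move=> cs Dr.
have : nbhs x (rotate c s @^-1` D) by exact: (rotate_continuous c s x).
apply: filterS => y /= Dy; apply: (D_revolution _ _ Dy).
  by rewrite rotate_radius.
by rewrite mxE.
Qed.

(** Rotating a boundary point in either direction never leads into the interior,
    which is invariant under rotations; so the defining function has no azimuthal
    derivative. *)
Lemma outward_normal_azimuth x n : outward_normal D x n ->
  - x 0 1 * n 0 0 + x 0 0 * n 0 1 = 0.
Proof.
move=> [rho [rho0 g0 drho Drho ->]].
set g := grad rho x in g0 *.
have dx : differentiable rho x by have [] := nbhs_singleton drho.
have Dx : ~ D° x by rewrite (nbhs_singleton Drho).1 rho0 ltxx.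
have key (e : R) : 0 <= e * (- x 0 1 * g 0 0 + x 0 0 * g 0 1).
  rewrite leNgt; apply/negP => ge.
  have gu : dotv g (vec3 (- e * x 0 1) (e * x 0 0) 0) < 0.
    move: ge; clearbody g; rewrite /dotv sum_I3 !vec3E.
    by apply: le_lt_trans; rewrite le_eqVlt; apply/orP; left; apply/eqP; ring.
  have c0 : rotate (cos (e * 0)) (sin (e * 0)) x = x by rewrite mulr0 rotate_cos0.
  have Drho' : \forall y \near x, D° y <-> rho y < 0 by apply: filterS Drho => y [].
  have [s /= Ds] := @filter_ex _ _ (at_right_proper_filter (0 : R)) _
    (descent_curve_enters D rho x (fun s => rotate (cos (e * s)) (sin (e * s)) x) _
      rho0 dx Drho'
      c0 (is_derive_rotate x e) gu).
  apply: Dx; apply: (interior_rotate (cos (e * s)) (sin (e * s))) Ds.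
  exact: cos2Dsin2.
(* rotations in both directions *)
have k1 := key 1; have k2 := key (- 1); clearbody g.
have -> : - x 0 1 * ((enorm g)^-1 *: g) 0 0 + x 0 0 * ((enorm g)^-1 *: g) 0 1 =
   (enorm g)^-1 * (- x 0 1 * g 0 0 + x 0 0 * g 0 1) by rewrite !mxE; ring.
suff -> : - x 0 1 * g 0 0 + x 0 0 * g 0 1 = 0 by rewrite mulr0.
by move: k1 k2; lra.
Qed.

End Revolution.

Lemma curl_vortex a x : rad2 x != 0 -> curl (fun y => a *: vortex y) x = 0.
Proof.
move=> x0; apply/rowP => i; rewrite !mxE !partial_velocity // !mxE.
by move: i; apply: forall_I3; rewrite /= subrr.
Qed.

Lemma vortex_navier_hodge_lions D (eta : R -> R) :
  (forall x y, D x -> cyl_radius y = cyl_radius x -> y 0 2 = x 0 2 -> D y) ->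
  (forall x, D x -> 0 < x 0 2 < 2 * cyl_radius x) ->
  navier_hodge_lions D (fun t x => eta t *: vortex x).
Proof.
move=> D_revolution D_cone t x n t0 nx.
have x0 := outward_normal_off_axis D D_cone x n nx; split.
- apply: differentiable_row => i.
  have -> : component (fun y => eta t *: vortex y) i = eta t \*: component vortex i.
    by apply/funext => y; rewrite /component mxE.
  by apply: differentiableZ; exact: differentiable_vortex_component.
- have H := outward_normal_azimuth D D_revolution x n nx.
  rewrite /dotv sum_I3 !mxE /=.
  transitivity (eta t * inv_rad2 x * (- x 0 1 * n 0 0 + x 0 0 * n 0 1)); first by ring.
  by rewrite H mulr0.
- rewrite curl_vortex //; apply/rowP => i; rewrite !mxE; ring.
Qed.

Lemma enorm_vortex_sqr a x : enorm (a *: vortex x) ^+ 2 = a ^+ 2 * inv_rad2 x.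
Proof.
have e : dotv (a *: vortex x) (a *: vortex x) = a ^+ 2 * inv_rad2 x.
  rewrite /dotv sum_I3 !mxE /=.
  transitivity (a ^+ 2 * (inv_rad2 x ^+ 2 * rad2 x)); first by rewrite /rad2; ring.
  congr (_ * _); rewrite /inv_rad2; have [->|x0] := eqVneq (rad2 x) 0.
    by rewrite invr0 mulr0.
  by field.
by rewrite sqr_sqrtr e // mulr_ge0 ?sqr_ge0 // invr_ge0 rad2_ge0.
Qed.

Lemma vortex_axisymmetric D a : axisymmetric_vector D (fun x => a *: vortex x).
Proof.
move=> x y Dx Dy x0 xy _.
have E z : dotv (a *: vortex z) (e_theta z) =
    a * inv_rad2 z * (cyl_radius z ^+ 2) / cyl_radius z.
  by rewrite cyl_radius_sqr /dotv sum_I3 !mxE /= /rad2; ring.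
split.
- have F z : dotv (a *: vortex z) (e_r z) = 0 by rewrite /dotv sum_I3 !mxE /=; ring.
  by rewrite !F.
- by rewrite !E /inv_rad2 -!cyl_radius_sqr xy.
- have F z : dotv (a *: vortex z) (e_3 R) = 0 by rewrite /dotv sum_I3 !mxE /=; ring.
  by rewrite !F.
Qed.

End Boundary.

(** * The cusp domain *)

Section Cusp.
Variable R : realType.
Local Notation V := 'rV[R]_3.
Implicit Types x y : V.
Variable beta : R.
Hypothesis beta2 : 2 < beta.

Lemma Dstar_revolution x y : Dstar beta x -> cyl_radius y = cyl_radius x ->
  y 0 2 = x 0 2 -> Dstar beta y.
Proof. by move=> [j j1 [jr jz]] yr yz; exists j => //; split; rewrite ?yr ?yz. Qed.

Lemma shell_height_le j : 2 `^ (- (beta * j%:R)) <= (2 ^- j : R).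
Proof.
rewrite -powR_mulrn // -powRN; apply: ler_powR; first by rewrite ler1n.
by rewrite lerN2 ler_peMl // (le_trans _ (ltW beta2)) // ler1n.
Qed.

(** On the shell of index j + 1 the height is at most 2^-j, which is at most 2 r. *)
Lemma Dstar_cone x : Dstar beta x -> 0 < x 0 2 < 2 * cyl_radius x.
Proof.
move=> [[//|j] _ [/= /andP[jr _] /andP[-> zj]]]; apply: (lt_le_trans zj).
apply: (le_trans (shell_height_le j)).
by rewrite mulrC -ler_pdivrMr // -invfM -exprSr.
Qed.

Lemma Dstar_off_axis x : Dstar beta x -> rad2 x != 0.
Proof.
move=> [j _ [/= /andP[jr _] _]]; rewrite -cyl_radius_sqr expf_neq0 // gt_eqF //.
by apply: lt_le_trans jr; rewrite invr_gt0 exprn_gt0.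
Qed.

Lemma Dstar_vortex_unbounded (eta : R -> R) : (forall t, 2 <= t -> eta t = 1) ->
  unbounded_on (Dstar beta) (fun t x => eta t *: vortex x).
Proof.
move=> eta1 M; have [j Mj] : exists j, M < 2 ^+ j.+1.
  exists (Num.truncn M); apply: lt_le_trans (truncnS_gt M) _.
  by rewrite -natrX ler_nat ltnW // ltn_expl.
(* on the inner edge of the shell of index j + 1, at half height, where |v| = 1 / r *)
pose x : V := vec3 (2 ^- j.+1) 0 (2 `^ (- (beta * j%:R)) / 2).
have p0 : 0 < (2 ^- j.+1 : R) by rewrite invr_gt0 exprn_gt0.
have rx : rad2 x = (2 ^- j.+1) ^+ 2 by rewrite /rad2 !vec3E expr0n addr0.
have cx : cyl_radius x = 2 ^- j.+1.
  by rewrite /cyl_radius -/(rad2 x) rx sqrtr_sqr gtr0_norm.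
have h0 : 0 < 2 `^ (- (beta * j%:R)) :> R by rewrite powR_gt0.
exists 2, x; split => //.
  exists j.+1 => //; split; rewrite ?cx ?vec3E.
    rewrite lexx /= ltf_pV2 ?posrE ?exprn_gt0 //.
    by rewrite exprS ltr_pMl ?exprn_gt0 // ltr1n.
  by rewrite /= divr_gt0 //= ltr_pdivrMr // ltr_pMr // ltr1n.
rewrite (lt_le_trans Mj) // -(@ler_pXn2r _ 2) ?nnegrE ?sqrtr_ge0 ?exprn_ge0 //.
by rewrite enorm_vortex_sqr eta1 // expr1n mul1r /inv_rad2 rx exprVn invrK.
Qed.

End Cusp.

(** * Measurability and integrability in Cartesian coordinates *)

Section Coords.
Variable R : realType.
Local Notation V := 'rV[R]_3.
Local Notation leb := (@lebesgue_measure R).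
Local Notation volume := ((leb \x leb) \x leb)%E.

Lemma coord_le_norm (x : V) i : `|x 0 i| <= `|x|.
Proof.
rewrite [leRHS]mx_normrE.
exact: (le_bigmax _ (fun ij : 'I_1 * 'I_3 => `|x ij.1 ij.2|) (0, i)).
Qed.

(** An open set is the countable union of the boxes with rational centres and
    sides 2 / (n + 1) that it contains, and boxes belong to the product
    sigma-algebra. *)
Lemma open_of_coords_measurable (U : set V) : open U ->
  measurable (@of_coords R @^-1` U : set (R * R * R)).
Proof.
move=> oU.
pose I (q : rat) (n : nat) : set R :=
  `](ratr q - n.+1%:R^-1), (ratr q + n.+1%:R^-1)[%classic.
pose box (q : rat * rat * rat * nat) : set (R * R * R) :=
  (I q.1.1.1 q.2 `*` I q.1.1.2 q.2) `*` I q.1.2 q.2.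
pose F q := if `[< box q `<=` of_coords (R:=R) @^-1` U >] then box q else set0.
have -> : @of_coords R @^-1` U = \bigcup_q F q.
  apply/seteqP; split => [z /= Uz|z [q _]]; last first.
    by rewrite /F; case: asboolP => // bU /bU.
  have /nbhs_ballP[e /= e0 eU] : nbhs (of_coords z) U by exact: open_nbhs_nbhs.
  pose n := Num.truncn (2 / e).
  have n0 : 0 < (n.+1%:R : R)^-1 by rewrite invr_gt0 ltr0n.
  have ne : 2 * (n.+1%:R : R)^-1 < e.
    by rewrite ltr_pdivrMr ?ltr0n // mulrC -ltr_pdivrMr // truncnS_gt.
  pose d : R := n.+1%:R^-1; rewrite -/d in n0 ne.
  have approx (a : R) : exists q : rat, a \in `](ratr q - d), (ratr q + d)[.
    have /rat_in_itvoo[q] : a - d < a + d by lra.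
    rewrite in_itv /= => /andP[q1 q2]; exists q; rewrite in_itv /=.
    by apply/andP; split; lra.
  have [q1 h1] := approx z.1.1; have [q2 h2] := approx z.1.2.
  have [q3 h3] := approx z.2.
  exists (q1, q2, q3, n) => //; rewrite /F.
  have zb : box (q1, q2, q3, n) z by [].
  case: asboolP => // -[] y /= [[y1 y2] y3]; apply: eU.
  move: h1 h2 h3 y1 y2 y3; rewrite /I /= !in_itv /= -/d.
  move=> /andP[? ?] /andP[? ?] /andP[? ?] /andP[? ?] /andP[? ?] /andP[? ?].
  rewrite mx_norm_ball /ball_ /= [ltLHS]mx_normrE.
  apply: bigmax_lt => // -[i k] _ /=; rewrite (ord1 i) !mxE.
  by move: k; apply: forall_I3 => /=; rewrite ltr_norml; lra.
apply: countable_bigcupT_measurable => [|q]; first exact: countableP.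
rewrite /F; case: asboolP => // _.
by apply: measurableX; [apply: measurableX|]; exact: measurable_itv.
Qed.

Lemma continuous_of_coords_measurable (g : V -> R) : continuous g ->
  measurable_fun [set: R * R * R] (fun z => g (of_coords z)).
Proof.
move=> cg; apply: (measurability _ (RGenOpens.measurableE R)).
move=> _ [_ [a [b ->] <-]]; rewrite setTI.
apply: (open_of_coords_measurable (g @^-1` `]a, b[)).
by move/continuousP: cg; apply; exact: interval_open.
Qed.

Lemma integrable_bounded_support d (T : measurableType d)
    (mu : {measure set T -> \bar R}) (A : set T) (f : T -> R) (C : R) :
  measurable A -> (mu A < +oo)%E ->
  measurable_fun setT f -> (forall z, `|f z| <= C) -> (forall z, ~ A z -> f z = 0) ->
  mu.-integrable setT (EFin \o f).
Proof.
move=> mA fA mf fC f0.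
have : mu.-integrable A (EFin \o f).
  apply: measurable_bounded_integrable => //; first exact: measurable_funTS.
  exists C; split; first exact: num_real.
  by move=> M CM z _; rewrite /= (le_trans (fC z)) // ltW.
move/(integrable_mkcond _ mA); congr (_.-integrable _ _).
apply/funext => z; rewrite patchE; case: ifPn => //.
by rewrite notin_setE => /f0 /= ->.
Qed.

Lemma itv_norm (M : R) : `[- M, M]%classic = [set x | `|x| <= M].
Proof. by apply/seteqP; split => x /=; rewrite in_itv /= ler_norml. Qed.

Definition cube (M : R) : set (R * R * R) :=
  (`[- M, M]%classic `*` `[- M, M]%classic) `*` `[- M, M]%classic.

Lemma measurable_cube M : measurable (cube M).
Proof. by apply: measurableX; [apply: measurableX|]; exact: measurable_itv. Qed.

Lemma finite_square (M : R) :
  ((leb \x leb)%E (`[- M, M]%classic `*` `[- M, M]%classic)%R < +oo)%E.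
Proof.
have mI : measurable `[- M, M]%classic by exact: measurable_itv.
have [r rE] : exists r : R, leb `[- M, M]%classic = r%:E.
  by rewrite lebesgue_measure_itv /=; case: ifP => _; [exists (M - - M)|exists 0].
rewrite product_measure1E //.
suff -> : (lebesgue_measure `[(- M)%R, M] * lebesgue_measure `[(- M)%R, M])%E =
    (r%:E * r%:E)%E :> \bar R by rewrite -EFinM ltry.
by congr (_ * _)%E; exact: rE.
Qed.

Lemma finite_cube M : (volume (cube M) < +oo)%E.
Proof.
have mI : measurable `[- M, M]%classic by exact: measurable_itv.
have [r rE] : exists r : R, leb `[- M, M]%classic = r%:E.
  by rewrite lebesgue_measure_itv /=; case: ifP => _; [exists (M - - M)|exists 0].
have mII := measurableX mI mI.
rewrite product_measure1E // [X in (X * _)%E]product_measure1E //.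
suff -> : (lebesgue_measure `[(- M)%R, M] * lebesgue_measure `[(- M)%R, M] *
    lebesgue_measure `[(- M)%R, M])%E = (r%:E * r%:E * r%:E)%E :> \bar R.
  by rewrite -!EFinM ltry.
by congr (_ * _ * _)%E; exact: rE.
Qed.

Lemma integrable_cube_support (f : V -> R) (M C : R) : continuous f ->
  (forall x, `|f x| <= C) -> (forall (x : V) i, M < `|x 0 i| -> f x = 0) ->
  volume.-integrable setT (EFin \o (fun z : R * R * R => f (of_coords z))).
Proof.
move=> cf fC f0.
apply: (integrable_bounded_support _ _ volume (cube M) _ C).
- exact: measurable_cube.
- exact: finite_cube.
- exact: continuous_of_coords_measurable.
- by move=> z; exact: fC.
- move=> [[a b] c] nz; apply: contrapT => nF; apply: nz; rewrite /cube itv_norm.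
  have o i : `|of_coords (a, b, c) 0 i| <= M.
    by rewrite leNgt; apply/negP => /f0.
  by move: (o 0) (o 1) (o 2); rewrite !mxE.
Qed.
End Coords.

(** * Vanishing integral of a compactly supported derivative *)

Section ProdEq0.
Local Open Scope ereal_scope.
Context d1 d2 (T1 : measurableType d1) (T2 : measurableType d2) (R : realType).
Context (m1 : {sigma_finite_measure set T1 -> \bar R}).
Context (m2 : {sigma_finite_measure set T2 -> \bar R}).
Context (f : T1 * T2 -> \bar R).
Hypothesis intf : (m1 \x m2).-integrable setT f.

Lemma integral_prod_eq0_left : (forall x, \int[m2]_y f (x, y) = 0) ->
  \int[m1 \x m2]_z f z = 0.
Proof.
move=> f0; rewrite -(integral12_prod_meas1 intf).
by apply: integral0_eq => x _; exact: f0.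
Qed.

Lemma integral_prod_eq0_right : (forall y, \int[m1]_x f (x, y) = 0) ->
  \int[m1 \x m2]_z f z = 0.
Proof.
move=> f0; rewrite -(integral21_prod_meas1 intf).
by apply: integral0_eq => y _; exact: f0.
Qed.
End ProdEq0.
Arguments integral_prod_eq0_left {d1 d2 T1 T2 R m1 m2 f}.
Arguments integral_prod_eq0_right {d1 d2 T1 T2 R m1 m2 f}.

Section Area.
Variable R : realType.
Local Notation leb := (@lebesgue_measure R).

(** A name of its own for the planar measure, so that it carries a sigma-finite
    structure and can be a factor in Fubini's theorem for the volume. *)
Definition area := (leb \x leb)%E.

HB.instance Definition _ := Measure.on area.

Lemma area_sigma_finite : sigma_finite setT area.
Proof.
pose I (n : nat) : set R := `[- n%:R, n%:R]%classic.
exists (fun n => I n `*` I n).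
  apply/seteqP; split => // -[a b] _.
  exists (Num.truncn (Num.max `|a| `|b|)).+1 => //.
  have h := truncnS_gt (Num.max `|a| `|b|).
  by split; rewrite /I /= in_itv /= -ler_norml (le_trans _ (ltW h)) //
    le_max lexx ?orbT.
move=> n; split; last exact: finite_square.
by apply: measurableX; exact: measurable_itv.
Qed.

HB.instance Definition _ := Measure_isSigmaFinite.Build _ _ _ area area_sigma_finite.
End Area.

Section Triple.
Local Open Scope ereal_scope.
Variable R : realType.
Local Notation leb := (@lebesgue_measure R).
Variable f : R * R * R -> \bar R.
Hypothesis intf : (area R \x leb).-integrable setT f.
Hypothesis slice : forall c, (leb \x leb).-integrable setT (fun ab => f (ab, c)).

(** For each of the three axes there is an order of integration in which its
    coordinate is integrated first. *)
Lemma integral_triple_eq0 :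
  [\/ forall b c, \int[leb]_a f (a, b, c) = 0,
      forall a c, \int[leb]_b f (a, b, c) = 0 |
      forall a b, \int[leb]_c f (a, b, c) = 0] ->
  \int[area R \x leb]_z f z = 0.
Proof.
case=> f0.
- apply: (integral_prod_eq0_right intf) => c.
  by apply: (integral_prod_eq0_right (slice c)) => b; exact: f0.
- apply: (integral_prod_eq0_right intf) => c.
  by apply: (integral_prod_eq0_left (slice c)) => b; exact: f0.
- by apply: (integral_prod_eq0_left intf) => -[a b]; exact: f0.
Qed.
End Triple.
Arguments integral_triple_eq0 {R f}.

Section Parts.
Variable R : realType.
Local Notation V := 'rV[R]_3.
Local Notation leb := (@lebesgue_measure R).
Local Notation volume := ((leb \x leb) \x leb)%E.

(** By the fundamental theorem of calculus on an interval whose end points lie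
    outside the support. *)
Lemma integral_derivative_eq0 (h h' : R -> R) (M : R) :
  (forall s : R, is_derive s (1 : R) h (h' s)) -> continuous h' ->
  (forall s, M < `|s| -> h s = 0 /\ h' s = 0) ->
  (\int[leb]_s (h' s)%:E = 0)%E.
Proof.
move=> dh ch' h0.
pose N := `|M| + 1.
have N0 : 0 < N by rewrite ltr_wpDl.
have MN : M < N by rewrite (le_lt_trans (ler_norm M)) // ltrDl.
have ch : continuous h.
  by move=> s; apply/differentiable_continuous/derivable1_diffP; have [] := dh s.
have -> : (\int[leb]_s (h' s)%:E = \int[leb]_(s in `[(- N)%R, N]) (h' s)%:E)%E.
  rewrite [RHS]integral_mkcond; apply: eq_integral => s _; rewrite patchE.
  case: ifPn => //; rewrite notin_setE /= in_itv /= => sN.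
  rewrite (h0 s _).2 // (lt_le_trans MN) // leNgt; apply/negP => /ltW.
  by rewrite ler_norml.
rewrite (@continuous_FTC2 R h' h (- N) N).
- by rewrite !(h0 _ _).1 ?subee // ?normrN gtr0_norm.
- by rewrite gtrN.
- exact: continuous_subspaceT.
- split; first by move=> s _; have [] := dh s.
  + exact: cvg_at_right_filter (ch _).
  + exact: cvg_at_left_filter (ch _).
- by move=> s _; rewrite derive1E; have [] := dh s.
Qed.

Lemma is_derive_slice (F : V -> R) (x : V) j (s : R) :
  derivable F (x + s *: ebase R j) (ebase R j) ->
  is_derive s (1 : R) (fun s => F (x + s *: ebase R j))
    (partial j F (x + s *: ebase R j)).
Proof.
have E : (fun k : R => k^-1 *:
      (((fun s => F (x + s *: ebase R j)) \o shift s) (k *: (1 : R))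
      - F (x + s *: ebase R j))) =
    (fun k : R => k^-1 *: ((F \o shift (x + s *: ebase R j)) (k *: ebase R j)
      - F (x + s *: ebase R j))).
  apply/funext => k /=; congr (_ *: (F _ - _)).
  by rewrite scalerDl addrCA -[k *: 1]/(k * 1) mulr1.
by move=> d; apply: DeriveDef; rewrite /derivable /partial /derive E.
Qed.

Lemma partial_eq0_near (F : V -> R) j (x : V) :
  (\forall y \near x, F y = 0) -> partial j F x = 0.
Proof.
by move=> n; rewrite /partial (@near_eq_derive _ _ _ F (cst 0)) ?derive_cst.
Qed.

Lemma partial_eq0_outside (F : V -> R) j (M : R) :
  (forall (x : V) i, M < `|x 0 i| -> F x = 0) ->
  forall (x : V) i, M < `|x 0 i| -> partial j F x = 0.
Proof.
move=> F0 x i Mx.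
have c : {for x, continuous (fun y : V => `|y 0 i|)}.
  apply: (@continuous_comp V R R (fun y : V => y 0 i) (fun u => `|u|)).
    exact: coord_continuous.
  exact: norm_continuous.
have nM : nbhs `|x 0 i| (fun u => M < u) by exact: lt_nbhsr.
have nx : \forall y \near x, M < `|(y : V) 0 i| := c _ nM.
by apply: partial_eq0_near; apply: filterS nx => y /F0.
Qed.

Lemma of_coords_slice (a b c : R) :
  [/\ of_coords (a, b, c) = vec3 0 b c + a *: ebase R 0,
      of_coords (a, b, c) = vec3 a 0 c + b *: ebase R 1 &
      of_coords (a, b, c) = vec3 a b 0 + c *: ebase R 2].
Proof.
by split; apply/rowP; apply: forall_I3;
  rewrite !mxE /= ?mulr1 ?mulr0 ?addr0 ?add0r.
Qed.

(** Integrate first along the lines parallel to the j-th axis.  Cube supports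
    make the volume integrand, and each of its horizontal slices, integrable, as
    Fubini's theorem requires. *)
Lemma integral_partial_eq0 (F : V -> R) j (M C : R) :
  (forall x, derivable F x (ebase R j)) -> continuous (partial j F) ->
  (forall (x : V) i, M < `|x 0 i| -> F x = 0) ->
  (forall x, `|partial j F x| <= C) ->
  (\int[volume]_z (partial j F (of_coords z))%:E = 0)%E.
Proof.
move=> dF cF F0 bF.
have F'0 := partial_eq0_outside F j M F0.
have mf : measurable_fun setT (fun z : R * R * R => partial j F (of_coords z)).
  exact: continuous_of_coords_measurable.
have int3 := integrable_cube_support R (partial j F) M C cF bF F'0.
(* along the line through x, the j-th coordinate is x_j + s *)
have line (x : V) : (\int[leb]_s (partial j F (x + s *: ebase R j))%:E = 0)%E.
  apply: (integral_derivative_eq0 (fun s => F (x + s *: ebase R j)) _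
     (M + `|x 0 j|)).
  - by move=> s; exact: is_derive_slice.
  - move=> s; apply: (@continuous_comp R V R (fun s => x + s *: ebase R j));
      last exact: cF.
    apply/differentiable_continuous/derivable1_diffP.
    by have [] := is_derive_line R x (ebase R j) s.
  - move=> s sM.
    have o : M < `|(x + s *: ebase R j) 0 j|.
      rewrite !mxE !eqxx mulr1.
      by have := ler_normB (x 0 j + s) (x 0 j); rewrite addrAC subrr add0r; lra.
    by split; [exact: F0 o|exact: F'0 o].
have slice c : (leb \x leb)%E.-integrable setT
    (EFin \o (fun ab : R * R => partial j F (of_coords (ab, c)))).
  apply: (integrable_bounded_support R _ _ (leb \x leb)%E
    (`[- M, M]%classic `*` `[- M, M]%classic) _ C).
  - by apply: measurableX; exact: measurable_itv.
  - by have := finite_square R M.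
  - by apply: (measurableT_comp mf); exact: measurable_fun_pair.
  - by move=> z; exact: bF.
  - move=> [a b] nz; apply: contrapT => nF; apply: nz; rewrite itv_norm.
    have o i : `|of_coords (a, b, c) 0 i| <= M.
      by rewrite leNgt; apply/negP => /F'0.
    by move: (o 0) (o 1); rewrite !mxE.
move: j dF cF bF F'0 mf int3 line slice; apply: forall_I3;
  move=> dF cF bF F'0 mf int3 line slice.
all: apply: (integral_triple_eq0 int3 slice).
- apply: Or31 => b c.
  rewrite -[RHS](line (vec3 0 b c)); apply: eq_integral => a _ /=.
  by have [->] := of_coords_slice a b c.
- apply: Or32 => a c.
  rewrite -[RHS](line (vec3 a 0 c)); apply: eq_integral => b _ /=.
  by have [_ -> _] := of_coords_slice a b c.
- apply: Or33 => a b.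
  rewrite -[RHS](line (vec3 a b 0)); apply: eq_integral => c _ /=.
  by have [_ _ ->] := of_coords_slice a b c.
Qed.
End Parts.

(** * Classical derivatives as weak derivatives *)

Section CompactSupport.
Variable R : realType.
Local Notation V := 'rV[R]_3.
Local Notation leb := (@lebesgue_measure R).
Local Notation volume := ((leb \x leb) \x leb)%E.
Variable K : set V.
Hypothesis cK : compact K.

Lemma near_notin_compact x : ~ K x -> \forall y \near x, ~ K y.
Proof.
move=> Kx; apply: open_nbhs_nbhs; split => //.
by apply: closed_openC; apply: compact_closed => //; exact: norm_hausdorff.
Qed.

Lemma compact_support_bounded (f : V -> R) : continuous f ->
  (forall x, ~ K x -> f x = 0) -> exists C, forall x, `|f x| <= C.
Proof.
move=> cf f0.
have /compact_bounded[M [_ HM]] : compact (f @` K).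
  by apply: continuous_compact => //; exact: continuous_subspaceT.
exists (`|M| + 1) => x; have [Kx|/f0->] := pselect (K x).
  by apply: HM; [rewrite (le_lt_trans (ler_norm M)) // ltrDl|exists x].
by rewrite normr0 addr_ge0.
Qed.

Lemma compact_in_cube : exists M : R, forall (x : V) i, M < `|x 0 i| -> ~ K x.
Proof.
have [M [_ HM]] := compact_bounded cK.
exists (`|M| + 1) => x i xM Kx; move: xM; apply/negP; rewrite -leNgt.
apply: le_trans (coord_le_norm R x i) _; apply: HM => //.
by rewrite (le_lt_trans (ler_norm M)) // ltrDl.
Qed.

Lemma compact_support_integrable (f : V -> R) : continuous f ->
  (forall x, ~ K x -> f x = 0) ->
  volume.-integrable setT (EFin \o (fun z : R * R * R => f (of_coords z))).
Proof.
move=> cf f0; have [C fC] := compact_support_bounded f cf f0.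
have [M KM] := compact_in_cube.
apply: (integrable_cube_support R f M C) => // x i /KM; exact: f0.
Qed.

(** The product vanishes near every point outside K, so the behaviour of u there,
    such as the singularity of the vortex on the axis, is harmless. *)
Lemma continuous_mul_compact_support (u b : V -> R) :
  (forall x, K x -> {for x, continuous u}) -> continuous b ->
  (forall x, ~ K x -> b x = 0) -> continuous (u * b).
Proof.
move=> cu cb b0 x; have [Kx|Kx] := pselect (K x).
  by apply: continuousM; [exact: cu|exact: cb].
have n : \forall y \near x, cst 0 y = (u * b) y.
  apply: filterS (near_notin_compact x Kx) => y /b0 by0.
  by rewrite -[RHS]/(u y * b y) by0 mulr0.
have ubx : (u * b) x = cst 0 x by rewrite -[LHS]/(u x * b x) b0 // mulr0.
rewrite /continuous_at ubx.
exact: cvg_trans (near_eq_cvg n) (@cst_continuous V R 0 x).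
Qed.

End CompactSupport.

Section WeakPartial.
Variable R : realType.
Local Notation V := 'rV[R]_3.
Local Notation leb := (@lebesgue_measure R).
Local Notation volume := ((leb \x leb) \x leb)%E.

Lemma space_integral_support (Omega : set V) (f : V -> R) :
  (forall x, ~ Omega x -> f x = 0) ->
  space_integral Omega (fun x => (f x)%:E) =
  (\int[volume]_z (f (of_coords z))%:E)%E.
Proof.
move=> f0; rewrite /space_integral integral_mkcond.
apply: eq_integral => z _; rewrite patchE; case: ifPn => //.
by rewrite notin_setE => /= /f0 ->.
Qed.

(** With phi supported in a compact subset K of Omega, u phi is a function on
    the whole space with the continuous partial derivative
    u d_j phi + g phi, whose integral vanishes. *)
Lemma classical_weak_partial (Omega : set V) j (u g : V -> R) :
  (forall x, Omega x -> is_derive x (ebase R j) u (g x)) ->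
  (forall x, Omega x -> {for x, continuous u}) ->
  (forall x, Omega x -> {for x, continuous g}) ->
  is_weak_partial Omega j u g.
Proof.
move=> du cu cg phi [tphi [K [cK KO phi0]]].
have [cphi dphi] := tphi [::]; have [cdphi _] := tphi [:: j].
rewrite /= in cphi dphi cdphi.
have dphi0 x : ~ K x -> partial j phi x = 0.
  move=> Kx; apply: partial_eq0_near.
  by apply: filterS (near_notin_compact R K cK x Kx) => y /phi0.
pose A := u * partial j phi; pose B := g * phi.
have A0 x : ~ K x -> A x = 0.
  by move=> Kx; rewrite -[LHS]/(u x * partial j phi x) dphi0 // mulr0.
have B0 x : ~ K x -> B x = 0.
  by move=> Kx; rewrite -[LHS]/(g x * phi x) phi0 // mulr0.
have cA : continuous A.
  by apply: (continuous_mul_compact_support R K cK) => // x /KO; exact: cu.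
have cB : continuous B.
  by apply: (continuous_mul_compact_support R K cK) => // x /KO; exact: cg.
(* off K both sides vanish, whatever u does there *)
have dF x : is_derive x (ebase R j) (u * phi) (A x + B x).
  have [Kx|Kx] := pselect (K x).
    have d1 := du x (KO x Kx); have d2 := derivableP (dphi j x).
    by apply: is_derive_eq; rewrite /GRing.scale /= [phi x * _]mulrC.
  have n : \forall y \near x, cst 0 y = (u * phi) y.
    apply: filterS (near_notin_compact R K cK x Kx) => y /phi0 by0.
    by rewrite -[RHS]/(u y * phi y) by0 mulr0.
  by apply: (near_eq_is_derive n); rewrite A0 // B0 // addr0; exact: is_derive_cst.
have pF : partial j (u * phi) = A + B.
  by apply/funext => x; have d := dF x; rewrite /partial derive_val.
have iA := compact_support_integrable R K cK A cA A0.
have iB := compact_support_integrable R K cK B cB B0.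
have KOc x : ~ Omega x -> ~ K x by move=> Ox /KO.
rewrite (space_integral_support Omega A) => [|x /KOc]; last exact: A0.
rewrite (space_integral_support Omega B) => [|x /KOc]; last exact: B0.
have cAB : continuous (A + B) by move=> x; apply: continuousD; [exact: cA|exact: cB].
have AB0 x : ~ K x -> (A + B) x = 0.
  by move=> Kx; rewrite -[LHS]/(A x + B x) A0 // B0 // addr0.
have [C bC] := compact_support_bounded R K cK _ cAB AB0.
have [M KM] := compact_in_cube R K cK.
have : (\int[volume]_z (partial j (u * phi) (of_coords z))%:E = 0)%E.
  apply: (integral_partial_eq0 R (u * phi) j M C); rewrite ?pF //.
  by move=> x i /KM Kx; rewrite -[LHS]/(u x * phi x) phi0 ?mulr0 //.
rewrite pF.
have -> : (\int[volume]_z ((A + B) (of_coords z))%:E =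
   \int[volume]_z (A (of_coords z))%:E + \int[volume]_z (B (of_coords z))%:E)%E.
  by rewrite -(integralD _ iA iB).
have := integrable_fin_num measurableT iA; have := integrable_fin_num measurableT iB.
rewrite /=; move: (integral _ _ (fun z => (A _)%:E)) => a.
move: (integral _ _ (fun z => (B _)%:E)) => b.
case: a => [a| |] //; case: b => [b| |] // _ _ [/eqP].
by rewrite addr_eq0 => /eqP ->.
Qed.
End WeakPartial.

(** * Integrability over the cusp *)

Section Integrals.
Variable R : realType.
Local Notation V := 'rV[R]_3.
Local Notation leb := (@lebesgue_measure R).
Local Notation volume := ((leb \x leb) \x leb)%E.

Lemma open_continuous_of_coords_measurable (U : set V) (h : V -> R) :
  open U -> (forall x, U x -> {for x, continuous h}) ->
  measurable_fun (@of_coords R @^-1` U : set (R * R * R)) (fun z => h (of_coords z)).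
Proof.
move=> oU ch; apply: (measurability _ (RGenOpens.measurableE R)).
move=> _ [_ [a [b ->] <-]].
have oab : open (`]a, b[%classic : set R) by exact: interval_open.
apply: (open_of_coords_measurable R (U `&` h @^-1` `]a, b[)).
rewrite openE => x [Ux hx].
apply: filterI; first exact: open_nbhs_nbhs.
by apply: (ch x Ux); exact: open_nbhs_nbhs.
Qed.

Lemma off_axis_open : open [set x : V | rad2 x != 0].
Proof. by rewrite openE => x; exact: near_off_axis. Qed.

Variable beta : R.
Hypothesis beta2 : 2 < beta.
Local Notation D := (Dstar beta).
Local Notation Dc := (@of_coords R @^-1` D : set (R * R * R)).

Lemma cyl_radius_continuous : continuous (@cyl_radius R).
Proof.
move=> x; apply: (@continuous_comp V R R rad2 (@Num.sqrt R)).
  exact/differentiable_continuous/differentiable_rad2.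
exact: sqrt_continuous.
Qed.

Lemma measurable_shell j :
  measurable (@of_coords R @^-1` shell beta j : set (R * R * R)).
Proof.
have m1 : measurable_fun setT (fun z : R * R * R => cyl_radius (of_coords z)).
  exact: continuous_of_coords_measurable cyl_radius_continuous.
have m2 : measurable_fun setT (fun z : R * R * R => (of_coords z : V) 0 2).
  apply: (continuous_of_coords_measurable R (fun x : V => x 0 2)).
  exact: coord_continuous.
rewrite (_ : _ @^-1` _ =
  (setT `&` (fun z : R * R * R => cyl_radius (of_coords z)) @^-1`
    `[2 ^- j, 2 ^- j.-1[) `&`
  (setT `&` (fun z : R * R * R => (of_coords z : V) 0 2) @^-1`
    `]0, 2 `^ (- (beta * j.-1%:R))[)).
  by apply: measurableI; [apply: m1|apply: m2] => //; exact: measurable_itv.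
by apply/seteqP; split => z /= => [[h1 h2]|[[_ h1] [_ h2]]]; do ?split => //;
  move: h1 h2; rewrite !in_itv.
Qed.

Lemma measurable_Dstar : measurable Dc.
Proof.
have -> : Dc = \bigcup_(j in [set j | (1 <= j)%N]) (@of_coords R @^-1` shell beta j).
  by rewrite preimage_bigcup.
by apply: bigcup_measurable => j _; exact: measurable_shell.
Qed.

Lemma Dstar_off_axis_coords : Dc `<=` (@of_coords R @^-1` [set x : V | rad2 x != 0]).
Proof. by move=> z /Dstar_off_axis. Qed.

(** Off the axis, an open set that contains the domain, continuity is enough for
    measurability. *)
Lemma off_axis_measurable (h : V -> R) :
  (forall x, rad2 x != 0 -> {for x, continuous h}) ->
  measurable_fun Dc (fun z => h (of_coords z)).
Proof.
move=> ch; apply: (measurable_funS _ Dstar_off_axis_coords).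
  by apply: open_of_coords_measurable; exact: off_axis_open.
exact: open_continuous_of_coords_measurable off_axis_open ch.
Qed.

Lemma continuous_inv_rad2X n (x : V) : rad2 x != 0 ->
  {for x, continuous (fun x => inv_rad2 x ^+ n)}.
Proof.
move=> x0; apply: (@continuous_comp V R R inv_rad2 (fun u => u ^+ n)).
  exact/differentiable_continuous/differentiable_inv_rad2.
exact: exprn_continuous.
Qed.

(** A box around the shell of index j + 1. *)
Definition slab (j : nat) : set (R * R * R) :=
  (`[- 2 ^- j, 2 ^- j]%classic `*` `[- 2 ^- j, 2 ^- j]%classic)
    `*` `[0, 2 `^ (- (beta * j%:R))]%classic.

Lemma measurable_slab j : measurable (slab j).
Proof. by apply: measurableX; [apply: measurableX|]; exact: measurable_itv. Qed.

Lemma shell_slab j z : shell beta j.+1 (of_coords z) -> slab j z.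
Proof.
rewrite /shell /= !mxE /= => -[/andP[_ rj] /andP[z0 zj]].
have [h1 h2] : `|z.1.1| <= 2 ^- j /\ `|z.1.2| <= 2 ^- j.
  by move: rj; rewrite /cyl_radius !vec3E => rj; split; rewrite (le_trans _ (ltW rj)) //
    -sqrtr_sqr ler_wsqrtr // ?lerDl ?lerDr sqr_ge0.
split; first by split; rewrite /= in_itv /= -ler_norml.
by rewrite /= in_itv /= (ltW z0) (ltW zj).
Qed.

Lemma volume_slab j : volume (slab j) =
  (4 * (2 ^- j) ^+ 2 * 2 `^ (- (beta * j%:R)))%:E.
Proof.
have p0 : 0 < 2 ^- j :> R by rewrite invr_gt0 exprn_gt0.
have h0 : 0 < 2 `^ (- (beta * j%:R)) :> R by rewrite powR_gt0.
have l1 : leb `[- 2 ^- j, 2 ^- j]%classic = (2 * 2 ^- j)%:E.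
  rewrite lebesgue_measure_itv /= lte_fin gtrN // -EFinB; congr (_%:E); ring.
have l2 : leb `[0, 2 `^ (- (beta * j%:R))]%classic = (2 `^ (- (beta * j%:R)))%:E.
  by rewrite lebesgue_measure_itv /= lte_fin h0 -EFinB subr0.
have l12 :
    (leb \x leb)%E (`[- 2 ^- j, 2 ^- j]%classic `*` `[- 2 ^- j, 2 ^- j]%classic)%R =
    ((2 * 2 ^- j)%:E * (2 * 2 ^- j)%:E)%E :> \bar R.
  by rewrite product_measure1E //; congr (_ * _)%E; exact: l1.
transitivity ((2 * 2 ^- j)%:E * (2 * 2 ^- j)%:E * (2 `^ (- (beta * j%:R)))%:E)%E.
  rewrite /slab product_measure1E; last 2 first.
  - by apply: measurableX; exact: measurable_itv.
  - exact: measurable_itv.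
  by congr (_ * _)%E; [exact: l12|exact: l2].
by rewrite -!EFinM; congr (_%:E); ring.
Qed.

Lemma shell_inv_rad2 j x : shell beta j.+1 x -> inv_rad2 x ^+ 2 <= 16 * 16 ^+ j.
Proof.
move=> [/= /andP[rj _] _]; rewrite /inv_rad2 -cyl_radius_sqr -exprS.
have p0 : 0 < 2 ^- j.+1 :> R by rewrite invr_gt0 exprn_gt0.
have c0 := lt_le_trans p0 rj.
rewrite exprVn -exprM (_ : (2 * 2 = 4)%N) // -(invrK (16 ^+ j.+1)).
rewrite lef_pV2 ?posrE ?exprn_gt0 ?invr_gt0 ?exprn_gt0 //.
rewrite (_ : (16 ^+ j.+1)^-1 = (2 ^- j.+1) ^+ 4); last first.
  by rewrite exprVn -exprM mulnC exprM; congr ((_ ^+ _)^-1); rewrite -natrX.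
by apply: lerXn2r rj; rewrite nnegrE ltW.
Qed.

Lemma geometric_nneseries_lty (a q : R) : `|q| < 1 ->
  (\sum_(j <oo) (a * q ^+ j)%:E < +oo)%E.
Proof.
move=> q1; have := @cvg_geometric_series R a q q1.
move=> h; have -> : (\sum_(j <oo) (a * q ^+ j)%:E =
    (limn (series (geometric a q)))%:E)%E.
  rewrite -EFin_lim; last by apply/cvg_ex; eexists; exact: h.
  by congr (limn _); apply/funext => n /=; rewrite -sumEFin.
exact: ltry.
Qed.

(** On the shell of index j + 1 one has r^-4 <= 16 * 16^j, and the shell lies in
    a box of volume 4 * 4^-j * 2^(- beta j).  The integral is thus at most the
    sum of 64 q^j with q = 2^(2 - beta) < 1. *)
Lemma Dstar_integral_lty :
  (\int[volume]_(z in Dc) ((inv_rad2 (of_coords z) ^+ 2)%R)%:E < +oo)%E.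
Proof.
pose q : R := 2 `^ (2 - beta).
have q0 : 0 < q by rewrite powR_gt0.
have q1 : `|q| < 1.
  rewrite gtr0_norm // /q /powR pnatr_eq0 /= expR_lt1 pmulr_llt0 ?subr_lt0 //.
  by rewrite ln_gt0 // ltr1n.
have qE j : q ^+ j = 4 ^+ j * 2 `^ (- (beta * j%:R)).
  rewrite /q -powR_mulrn ?powR_ge0 // -powRrM mulrBl powRD ?pnatr_eq0 ?implybT //.
  by rewrite -mulNr; congr (_ * _); rewrite powRrM !powR_mulrn // -natrX.
have mS : measurable_fun Dc (fun z => inv_rad2 (of_coords z) ^+ 2).
  apply: (off_axis_measurable (fun x => inv_rad2 x ^+ 2)) => x x0.
  exact: continuous_inv_rad2X.
pose c j : R := 16 * 16 ^+ j.
have c0 j : 0 <= c j by rewrite mulr_ge0 // exprn_ge0.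
have mI j : measurable_fun Dc (fun z => (c j * \1_(slab j) z)%:E).
  apply/measurable_EFinP; apply: measurable_funM => //.
  by apply: measurable_indic; exact: measurable_slab.
have I0 j z : Dc z -> (0 <= (c j * \1_(slab j) z)%:E)%E.
  by move=> _; rewrite lee_fin mulr_ge0.
apply: (@le_lt_trans _ _
  (\int[volume]_(z in Dc) (\sum_(j <oo) (c j * \1_(slab j) z)%:E))%E).
  apply: ge0_le_integral.
  - exact: measurable_Dstar.
  - by move=> z _; rewrite lee_fin exprn_ge0 // invr_ge0 rad2_ge0.
  - exact/measurable_EFinP.
  - apply: ge0_emeasurable_sum => [j z zD _|j _]; first exact: I0.
    exact: mI.
  - (* a point of the shell of index j + 1 lies in the slab of index j, and the
       j-th term is at most the whole series *)
    move=> z [[//|j] _ zj].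
    apply: le_trans (@nneseries_lim_ge R _ xpredT 0%N j.+1 _); last first.
      by move=> n _ _; rewrite lee_fin mulr_ge0.
    rewrite sumEFin lee_fin big_nat_recr //=.
    rewrite [X in _ <= _ + _ * X](_ : _ = 1); last first.
      by rewrite indicE mem_set //; exact: shell_slab.
    rewrite mulr1 (le_trans (shell_inv_rad2 j _ zj)) // lerDr.
    by apply: sumr_ge0 => i _; rewrite mulr_ge0.
rewrite integral_nneseries; [|exact: measurable_Dstar|exact: mI|exact: I0].
apply: le_lt_trans (geometric_nneseries_lty 64 q q1).
apply: lee_nneseries => [j _ _|j _]; first by apply: integral_ge0 => z; exact: I0.
under eq_integral do rewrite EFinM.
have mind : measurable_fun Dc (fun z => (\1_(slab j) z : R)%:E).
  by apply/measurable_EFinP; apply: measurable_indic; exact: measurable_slab.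
rewrite ge0_integralZl_EFin;
  [|exact: measurable_Dstar|by move=> z _; rewrite lee_fin|exact: mind|exact: c0].
rewrite integral_indic; [|exact: measurable_Dstar|exact: measurable_slab].
apply: (@le_trans _ _ ((c j)%:E * volume (slab j))%E).
  rewrite lee_wpmul2l ?lee_fin //; apply: le_measure.
  - rewrite inE; apply: measurableI; first exact: measurable_slab.
    exact: measurable_Dstar.
  - by rewrite inE; exact: measurable_slab.
  - exact: subIsetl.
rewrite volume_slab -EFinM lee_fin qE /c le_eqVlt; apply/orP; left; apply/eqP.
have -> : (16 : R) ^+ j = 4 ^+ j * 4 ^+ j by rewrite -exprMn -natrM.
have -> : (2 ^- j : R) ^+ 2 = (4 ^+ j)^-1.
  by rewrite exprVn -exprM mulnC exprM -natrX.
have : (4 : R) ^+ j != 0 by rewrite expf_neq0 // pnatr_eq0.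
by move: (4 ^+ j) => x x0; field.
Qed.
End Integrals.

(** * The energy class and the force class *)

Section Spaces.
Variable R : realType.
Local Notation V := 'rV[R]_3.
Local Notation leb := (@lebesgue_measure R).
Local Notation volume := ((leb \x leb) \x leb)%E.
Variable beta : R.
Hypothesis beta2 : 2 < beta.
Local Notation D := (Dstar beta).
Local Notation Dc := (@of_coords R @^-1` D : set (R * R * R)).

Lemma measurable_inv_rad2X n :
  measurable_fun Dc (fun z => ((inv_rad2 (of_coords z) ^+ n)%R)%:E).
Proof.
apply/measurable_EFinP; apply: (off_axis_measurable R beta (fun x => inv_rad2 x ^+ n)).
by move=> x x0; exact: continuous_inv_rad2X.
Qed.

Lemma Dstar_inv_rad2_ge1 x : D x -> 1 <= inv_rad2 x.
Proof.
move=> [[//|j] _ [/= /andP[r1 r2] _]].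
have r0 : 0 < cyl_radius x by apply: lt_le_trans r1; rewrite invr_gt0 exprn_gt0.
rewrite /inv_rad2 -cyl_radius_sqr invf_ge1 ?exprn_gt0 // expr_le1 // ?ltW //.
apply: lt_le_trans r2 _; rewrite invf_le1 ?exprn_gt0 //.
by rewrite exprn_ege1 // ler1n.
Qed.

(** As 1 / r >= 1 on the domain, the powers of 1 / r up to the fourth are
    dominated by the fourth. *)
Lemma Dstar_integral_inv_rad2X n : (n <= 2)%N -> exists a : R, 0 <= a /\
  space_integral D (fun x => (inv_rad2 x ^+ n)%:E) = a%:E.
Proof.
move=> n2.
have h0 : (0 <= space_integral D (fun x => (inv_rad2 x ^+ n)%:E))%E.
  by apply: integral_ge0 => z _; rewrite lee_fin exprn_ge0 // invr_ge0 rad2_ge0.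
have hy : (space_integral D (fun x => (inv_rad2 x ^+ n)%:E) < +oo)%E.
  apply: le_lt_trans (Dstar_integral_lty R beta beta2).
  apply: ge0_le_integral.
  - exact: measurable_Dstar.
  - by move=> z _; rewrite lee_fin exprn_ge0 // invr_ge0 rad2_ge0.
  - exact: measurable_inv_rad2X.
  - exact: measurable_inv_rad2X.
  - move=> z /Dstar_inv_rad2_ge1 z1; rewrite lee_fin.
    exact: ler_weXn2l.
by move: h0 hy; case: (space_integral _ _) => [a| |] // a0 _; exists a.
Qed.

Lemma space_integral_scale (k : R) n (g : V -> R) : 0 <= k ->
  (forall x, g x = k * inv_rad2 x ^+ n) ->
  (space_integral D (fun x => (g x)%:E) =
    k%:E * space_integral D (fun x => (inv_rad2 x ^+ n)%:E))%E.
Proof.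
move=> k0 gE; rewrite /space_integral.
transitivity (\int[volume]_(z in Dc) (k%:E * ((inv_rad2 (of_coords z) ^+ n)%R)%:E))%E.
  by apply: eq_integral => z _; rewrite gE EFinM.
rewrite ge0_integralZl_EFin //.
- exact: measurable_Dstar.
- by move=> z _; rewrite lee_fin exprn_ge0 // invr_ge0 rad2_ge0.
- exact: measurable_inv_rad2X.
Qed.

Lemma separated_measurable_on_cylinder (T : R) (g : R -> V -> R)
    (e : R -> R) (h : V -> R) :
  continuous (fun t : R => e (Num.max 0 t)) ->
  (forall x, rad2 x != 0 -> {for x, continuous h}) ->
  (forall t x, 0 <= t -> D x -> g t x = e t * h x) ->
  measurable_on_cylinder D T g.
Proof.
move=> ce ch gE.
apply: (@eq_measurable_fun _ _ _ _ _
   (fun z : R * R * R * R => e (Num.max 0 z.2) * h (of_coords z.1))).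
  move=> z; rewrite inE => -[Dz]; rewrite /= in_itv /= => /andP[z0 _].
  by rewrite gE // max_r.
apply: measurable_funM.
  have mt := measurableT_comp (continuous_measurable_fun ce)
    (@measurable_snd _ _ (R * R * R)%type R).
  exact: measurable_funTS mt.
apply: (@measurable_comp _ _ _ _ _ _ Dc (fun z => h (of_coords z)) _ fst).
- exact: measurable_Dstar.
- by move=> _ [z [Dz _] <-].
- exact: off_axis_measurable.
- by apply: measurable_funTS; exact: measurable_fst.
Qed.

Lemma clamp_bounded (e : R -> R) (T : R) :
  continuous (fun t : R => e (Num.max 0 t)) ->
  exists M, forall t, 0 <= t <= T -> e t ^+ 2 <= M ^+ 2.
Proof.
move=> ce.
have /compact_bounded[M [_ HM]] : compact ((fun t => e (Num.max 0 t)) @` `[0, T]).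
  by apply: continuous_compact; [exact: continuous_subspaceT|exact: segment_compact].
exists (`|M| + 1) => t tT; rewrite -(ger0_norm (sqr_ge0 (e t))) normrX.
rewrite lerXn2r ?nnegrE //; apply: HM.
  by rewrite (le_lt_trans (ler_norm M)) // ltrDl.
by exists t; rewrite /= ?in_itv //=; case/andP: tT => t0 _; rewrite max_r.
Qed.

Variable eta : R -> R.
Hypothesis eta_smooth : time_smooth eta.
Let v t x := eta t *: vortex x.
Let f t x := - (time_derive eta t *: vortex x).

Let clamp_eta : continuous (fun t : R => eta (Num.max 0 t)).
Proof. by apply: clamp_continuous => t; exact: eta_smooth 0%N t. Qed.

(** Since (x_1^2 - x_0^2)^2 + (2 x_0 x_1)^2 = r^4. *)
Lemma vortex_grad_sqr (x : V) :
  \sum_i \sum_j vortex_grad x i j ^+ 2 = 2 * inv_rad2 x ^+ 2.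
Proof.
rewrite !sum_I3 !mxE /= /grad_a /grad_b.
transitivity (2 * (inv_rad2 x ^+ 2 * rad2 x) ^+ 2); first by rewrite /rad2; ring.
rewrite /inv_rad2; have [->|x0] := eqVneq (rad2 x) 0.
  by rewrite invr0 expr0n /= mul0r expr0n.
by field.
Qed.

(** The two parts of the energy at time t are 2 (eta t)^2 and (eta t)^2 times
    constants, and eta is bounded on [0, T]. *)
Lemma vortex_energy T : 0 < T -> in_energy_space D T v.
Proof.
move=> T0; pose G t x := eta t *: vortex_grad x.
have [M HM] := clamp_bounded eta T clamp_eta.
have [a1 [a1_ge0 A1]] := Dstar_integral_inv_rad2X 1 isT.
have [a2 [a2_ge0 A2]] := Dstar_integral_inv_rad2X 2 isT.
exists G; split.
- move=> i; apply: (separated_measurable_on_cylinder T _ eta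
    (component vortex i)) => //.
    by move=> x x0; exact/differentiable_continuous/differentiable_vortex_component.
  by move=> t x _ _; rewrite /v mxE.
- move=> i j; apply: (separated_measurable_on_cylinder T _ eta
    (fun x => vortex_grad x i j)) => //.
    by move=> x x0; exact/differentiable_continuous/differentiable_vortex_grad.
  by move=> t x _ _; rewrite /G mxE.
- apply: nearW => t _ i j; apply: classical_weak_partial.
  + move=> x /interior_subset /Dstar_off_axis x0.
    have := is_derive_velocity R x x0 (eta t) (ebase R j) i.
    rewrite sum_ebase /G.
    by rewrite [X in is_derive _ _ _ X -> _](_ : _ = (eta t *: vortex_grad x) i j)
      // [RHS]mxE.
  + move=> x /interior_subset /Dstar_off_axis x0.
    apply: differentiable_continuous.
    have -> : component (v t) i = eta t \*: component vortex i.
      by apply/funext => y; rewrite /component mxE.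
    by apply: differentiableZ; exact: differentiable_vortex_component.
  + move=> x /interior_subset /Dstar_off_axis x0.
    apply: differentiable_continuous.
    have -> : (fun x => G t x i j) = eta t \*: (fun x => vortex_grad x i j).
      by apply/funext => y; rewrite /G mxE.
    by apply: differentiableZ; exact: differentiable_vortex_grad.
- have gradE t : space_integral D (fun x => (\sum_i \sum_j G t x i j ^+ 2)%:E) =
      ((2 * eta t ^+ 2)%:E * a2%:E)%E.
    have k0 : 0 <= 2 * eta t ^+ 2 by rewrite mulr_ge0 // sqr_ge0.
    rewrite (space_integral_scale _ 2 _ k0) ?A2 // => x.
     rewrite -mulrA mulrCA -vortex_grad_sqr mulr_sumr; apply: eq_bigr => i _.
    by rewrite mulr_sumr; apply: eq_bigr => j _; rewrite /G mxE exprMn.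
  have velE t : space_integral D (fun x => (enorm (v t x) ^+ 2)%:E) =
      ((eta t ^+ 2)%:E * a1%:E)%E.
    rewrite (space_integral_scale (eta t ^+ 2) 1) ?A1 ?sqr_ge0 //.
    by move=> x; rewrite enorm_vortex_sqr.
  have tT t : `[0, T]%classic t -> 0 <= t <= T by rewrite /= in_itv.
  apply: lte_add_pinfty.
    apply: (@le_lt_trans _ _
      (\int[leb]_(t in `[0%R, T]) (cst (2 * M ^+ 2 * a2)%:E) t)%E).
      apply: ge0_le_integral.
      * exact: measurable_itv.
      * by move=> t _; rewrite gradE -EFinM lee_fin mulr_ge0 // mulr_ge0 // sqr_ge0.
      * apply: (@eq_measurable_fun _ _ _ _ _
          (fun t : R => (2 * eta (Num.max 0 t) ^+ 2 * a2)%:E)).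
          by move=> t; rewrite inE => /tT /andP[t0 _]; rewrite gradE -EFinM max_r.
        apply/measurable_EFinP; apply: measurable_funTS.
        apply: measurable_funM => //; apply: measurable_funM => //.
        by apply: measurable_funX; exact: continuous_measurable_fun clamp_eta.
      * exact: measurable_cst.
      * move=> t /tT tt; rewrite gradE -EFinM lee_fin ler_wpM2r // ler_wpM2l //.
        exact: HM.
    rewrite integral_cst //= lebesgue_measure_itv /= lte_fin T0 -EFinB -EFinM.
    exact: ltry.
  apply: (@le_lt_trans _ _ (M ^+ 2 * a1)%:E); last exact: ltry.
  apply: ge_ereal_sup => _ [t /tT tt <-].
  by rewrite velE -EFinM lee_fin ler_wpM2r //; exact: HM.
Qed.

(** The L^2 norm of the force at time t is |eta' t| times that of 1 / r. *)
Lemma vortex_force_Linfty_L2 T : 0 < T -> in_Linfty_Lp D T 2 f.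
Proof.
move=> T0.
have ce := time_derive_clamp_continuous R eta eta_smooth.
have [M HM] := clamp_bounded (time_derive eta) T ce.
have [a1 [a1_ge0 A1]] := Dstar_integral_inv_rad2X 1 isT.
have fN t x : enorm (f t x) ^+ 2 = time_derive eta t ^+ 2 * inv_rad2 x.
  by rewrite /f -scaleNr enorm_vortex_sqr sqrrN.
split.
  move=> i; apply: (separated_measurable_on_cylinder T _ (time_derive eta)
    (- component vortex i)) => //.
    move=> x x0; apply: differentiable_continuous; apply: differentiableN.
    exact: differentiable_vortex_component.
  by move=> t x _ _; rewrite /f mxE [X in - X = _]mxE -mulrN.
have LE t : Lp_norm D 2 (f t) = ((time_derive eta t ^+ 2 * a1)%:E `^ 2^-1)%E.
  rewrite /Lp_norm unlock; congr (_ `^ _)%E.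
  rewrite EFinM -A1 -(space_integral_scale (time_derive eta t ^+ 2) 1
    (fun x => enorm (f t x) ^+ 2)) ?sqr_ge0 //.
  rewrite /space_integral [RHS]integral_mkcond; apply: eq_integral => z _.
  rewrite !patchE; case: ifPn => _; last by rewrite abse0 poweR0r ?invr_eq0 ?pnatr_eq0.
  by rewrite gee0_abs ?lee_fin ?sqrtr_ge0 // poweR_EFin powR_mulrn ?sqrtr_ge0.
apply: (@le_lt_trans _ _ ((M ^+ 2 * a1)%:E `^ 2^-1)%E);
  last by rewrite poweR_lty // ltry.
apply/ess_supP; apply: nearW => t; rewrite patchE.
case: ifPn => [|_]; last exact: poweR_ge0.
rewrite inE /= in_itv /= => tT; rewrite LE !poweR_EFin lee_fin.
have pos (k : R) : k ^+ 2 * a1 \in Num.nneg by rewrite nnegrE mulr_ge0 // sqr_ge0.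
by apply: ge0_ler_powR; rewrite ?invr_ge0 ?pos // ler_wpM2r //; exact: HM.
Qed.

End Spaces.

(** * The vortex solution *)

Theorem proposition7p2 (R : realType) (beta : R) (eta : R -> R)
    (hbeta : 2 < beta)
    (eta_smooth : time_smooth eta)
    (eta0 : forall t : R, 0 <= t <= 1 -> eta t = 0)
    (eta1 : forall t : R, 2 <= t -> eta t = 1) :
  let D : set 'rV[R]_3 := Dstar beta in
  let v : R -> 'rV[R]_3 -> 'rV[R]_3 :=
    fun t x => (eta t / cyl_radius x) *: e_theta x in
  let f : R -> 'rV[R]_3 -> 'rV[R]_3 :=
    fun t x => - ((time_derive eta t / cyl_radius x) *: e_theta x) in
  [/\ exists P : R -> 'rV[R]_3 -> R,
        navier_stokes_solution D f v P /\
        (forall t : R, 0 <= t -> axisymmetric_scalar D (P t)),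
      forall t : R, 0 <= t -> axisymmetric_vector D (v t),
      unbounded_on D v,
      navier_hodge_lions D v &
      forall T : R, 0 < T ->
        in_energy_space D T v /\
        exists p : R, 3 / 2 < p /\ in_Linfty_Lp D T p f].
Proof.
move=> D v f.
have vE : v = fun t x => eta t *: vortex x.
  by apply/funext => t; apply/funext => x; exact: vortexE.
have fE : f = fun t x => - (time_derive eta t *: vortex x).
  by apply/funext => t; apply/funext => x; rewrite /f vortexE.
rewrite vE fE; split.
- exists (pressure eta); split.
    apply: vortex_solves => // x; exact: Dstar_off_axis.
  move=> t t0 x y Dx Dy x0 xy _.
  by rewrite /pressure /inv_rad2 -!cyl_radius_sqr xy.
- by move=> t t0; exact: vortex_axisymmetric.
- exact: Dstar_vortex_unbounded.
- apply: vortex_navier_hodge_lions; [exact: Dstar_revolution|exact: Dstar_cone].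
- move=> T T0; split; first exact: vortex_energy.
  exists 2; split; [lra|exact: vortex_force_Linfty_L2].
Qed.
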